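(* Every set of EFD-sentences in the language $\{+,\neg,0\}$ is equivalent over $\mathsf{V}(\mathcal{P})$ to exactly one of the following: $\{\forall xy\,x=y\}$; $\{\forall x\,2x=x\}$; $\Sigma_S:=\{\varepsilon_p:p\in S\}$ for some set $S$ of prime numbers. Furthermore, the map $S\mapsto\Sigma_S$ is one-to-one (distinct $S$ give non-equivalent sets over $\mathsf V(\mathcal P)$), and thus the lattice of AE-subclasses of $\mathsf{V}(\mathcal{P})$, ordered by inclusion, is isomorphic with $\mathbf{2}\oplus\mathbf{2}^\omega$.
   Context: An MV-algebra is an algebra $(A,+,\neg,0)$ with $(A,+,0)$ an Abelian monoid, $\neg\neg x=x$, $x+\neg0=\neg0$, $\neg(\neg x+y)+y=\neg(\neg y+x)+x$. Write $1:=\neg0$, $x\vee y:=\neg(\neg x+y)+y$, $x\wedge y:=\neg(\neg x\vee\neg y)$, $x*y:=\neg(\neg x+\neg y)$, $ka=a+\dots+a$ ($k$ times), $a^k=a*\dots*a$ ($k$ times). An ideal is a nonempty down-set closed under $+$; the radical $\mathrm{rad}\,\mathbf A$ is the intersection of all maximal ideals. $\mathbf A$ is perfect if it is nontrivial and $A=\mathrm{rad}\,\mathbf A\cup\{\neg a:a\in\mathrm{rad}\,\mathbf A\}$. $\mathcal P$ is the class of perfect MV-algebras and $\mathsf V(\mathcal P)$ the variety it generates. For a positive integer $k$, $\mathsf t_k(z):=(kz\wedge\neg 2z^2)\vee z^k$ and $\varepsilon_k:=\forall x\exists! z\;\mathsf t_k(z)=x$. An EFD-sentence is a sentence $\forall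 x_1\dots x_n\exists! z_1\dots z_m\bigwedge_{i=1}^k s_i(\bar x,\bar z)=t_i(\bar x,\bar z)$ with terms $s_i,t_i$, $n\ge0$, $m\ge1$. Two sets of sentences are equivalent over a class if they have the same models in it. An AE-subclass of $\mathsf V(\mathcal P)$ is a class $\mathsf V(\mathcal P)\cap\mathrm{Mod}(\Sigma)$ with $\Sigma$ a set of EFD-sentences. $\mathbf 2$ is the two-element lattice, $\mathbf 2^\omega$ the lattice of subsets of a countably infinite set, $\oplus$ ordinal sum (first summand below). *)

(* Defs.v *)
From mathcomp Require Import all_boot all_order.
From mathcomp Require Import boolp classical_sets.
Set Implicit Arguments.
Unset Strict Implicit.
Unset Printing Implicit Defensive.

Local Open Scope classical_set_scope.

(* Algebras in the language {+, ¬, 0}, with no axioms imposed; classes of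
   algebras are predicates [mvstr -> Prop]. *)
Record mvstr : Type := MVStr {
  carrier :> Type;
  mvadd : carrier -> carrier -> carrier;
  mvneg : carrier -> carrier;
  mvzero : carrier }.

Arguments mvadd {m} _ _.
Arguments mvneg {m} _.
Arguments mvzero {m}.

Declare Scope mv_scope.
Delimit Scope mv_scope with MV.
Local Open Scope mv_scope.
Notation "x + y" := (mvadd x y) : mv_scope.
Notation "¬ x" := (mvneg x) (at level 35, right associativity) : mv_scope.
Notation "0" := mvzero : mv_scope.

Definition mvone {A : mvstr} : A := ¬ 0.
Definition mvjoin {A : mvstr} (x y : A) : A := (¬ ((¬ x) + y)) + y.
Definition mvmeet {A : mvstr} (x y : A) : A := ¬ (mvjoin (¬ x) (¬ y)).
Definition mvmul {A : mvstr} (x y : A) : A := ¬ ((¬ x) + (¬ y)).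
(* [iterop k op a e] is [op a (... (op a a))] with [k] occurrences of [a]
   (and [e] when [k] is 0). *)
Definition mvmuln {A : mvstr} (k : nat) (a : A) : A := iterop k mvadd a 0.
Definition mvexp {A : mvstr} (a : A) (k : nat) : A := iterop k mvmul a mvone.
Definition mvle {A : mvstr} (x y : A) : Prop := mvjoin x y = y.

Record is_MV (A : mvstr) : Prop := IsMV {
  mvaddA : forall x y z : A, x + (y + z) = (x + y) + z;
  mvaddC : forall x y : A, x + y = y + x;
  mvadd0 : forall x : A, x + 0 = x;
  mvnegK : forall x : A, ¬ (¬ x) = x;
  mvadd1 : forall x : A, x + (¬ 0) = ¬ 0;
  mvjoin_ax : forall x y : A,
    (¬ ((¬ x) + y)) + y = (¬ ((¬ y) + x)) + x }.

Record is_ideal (A : mvstr) (I : set A) : Prop := IsIdeal {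
  ideal_nonempty : I !=set0;
  ideal_down : forall x y : A, mvle x y -> I y -> I x;
  ideal_add : forall x y : A, I x -> I y -> I (x + y) }.

Definition is_maximal_ideal (A : mvstr) (I : set A) : Prop :=
  [/\ is_ideal I, I <> setT &
      forall J : set A, is_ideal J -> I `<=` J -> J <> setT -> J = I].

Definition mvrad (A : mvstr) : set A :=
  [set a | forall I : set A, is_maximal_ideal I -> I a].
Arguments mvrad : clear implicits.

Definition perfect (A : mvstr) : Prop :=
  [/\ is_MV A,
      exists x y : A, x <> y &
      [set: A] = mvrad A `|` (@mvneg A @` mvrad A)].

Definition is_hom (A B : mvstr) (f : A -> B) : Prop :=
  [/\ forall x y : A, f (x + y) = f x + f y,
      forall x : A, f (¬ x) = ¬ (f x) &
      f 0 = 0].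

Definition prod_mvstr (I : Type) (A : I -> mvstr) : mvstr :=
  @MVStr (forall i, A i) (fun x y i => x i + y i) (fun x i => ¬ (x i))
         (fun i => 0).

(* Closure under subalgebras is stated through embeddings, so that a variety
   is closed under isomorphism; [I] may be empty. *)
Record is_variety (K : mvstr -> Prop) : Prop := IsVariety {
  variety_hom : forall (A B : mvstr) (f : A -> B),
    is_hom f -> (forall b : B, exists a : A, f a = b) -> K A -> K B;
  variety_sub : forall (A B : mvstr) (f : A -> B),
    is_hom f -> injective f -> K B -> K A;
  variety_prod : forall (I : Type) (A : I -> mvstr),
    (forall i, K (A i)) -> K (prod_mvstr A) }.

Definition variety_gen (P : mvstr -> Prop) (A : mvstr) : Prop :=
  forall K : mvstr -> Prop,
    is_variety K -> (forall B : mvstr, P B -> K B) -> K A.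

Definition VP : mvstr -> Prop := variety_gen perfect.

Inductive term (V : Type) : Type :=
| TVar of V
| TAdd of term V & term V
| TNeg of term V
| TZero.
Arguments TZero {V}.

(* The derived operations above apply to terms through this structure. *)
Definition term_mvstr (V : Type) : mvstr :=
  @MVStr (term V) (@TAdd V) (@TNeg V) TZero.

Definition mvvar (V : Type) (v : V) : term_mvstr V := TVar v.

Fixpoint eval (A : mvstr) (V : Type) (e : V -> A) (t : term V) : A :=
  match t with
  | TVar v => e v
  | TAdd t1 t2 => eval e t1 + eval e t2
  | TNeg t1 => ¬ (eval e t1)
  | TZero => 0
  end.

(* [Identity s t] is the sentence ∀ x_1 … x_n, s = t.
   [Efd s t] is the sentence
     ∀ x_1 … x_n ∃! z_1 … z_(m+1), ⋀_(i < k+1) s_i(x, z) = t_i(x, z);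
   a variable [inl i] stands for an x and [inr j] for a z. *)
Inductive sentence : Type :=
| Identity (n : nat) (s t : term 'I_n)
| Efd (n m k : nat) (s t : 'I_k.+1 -> term ('I_n + 'I_m.+1)).

Definition is_efd : set sentence :=
  [set phi | if phi is Efd _ _ _ _ _ then True else False].

Definition sum_env (A : Type) (X Z : Type) (x : X -> A) (z : Z -> A)
    (v : X + Z) : A :=
  match v with inl i => x i | inr j => z j end.

Definition satisfies (A : mvstr) (phi : sentence) : Prop :=
  match phi with
  | Identity n s t => forall x : 'I_n -> A, eval x s = eval x t
  | Efd n m k s t =>
      forall x : 'I_n -> A, exists! z : 'I_m.+1 -> A,
        forall i : 'I_k.+1,
          eval (sum_env x z) (s i) = eval (sum_env x z) (t i)
  end.

Definition models (A : mvstr) (Sigma : set sentence) : Prop :=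
  forall phi, Sigma phi -> satisfies A phi.

Definition equiv_over (K : mvstr -> Prop) (Sigma Sigma' : set sentence) : Prop :=
  forall A : mvstr, K A -> (models A Sigma <-> models A Sigma').

Definition t_ {A : mvstr} (k : nat) (z : A) : A :=
  mvjoin (mvmeet (mvmuln k z) (¬ (mvmuln 2 (mvexp z 2)))) (mvexp z k).

Definition epsilon (k : nat) : sentence :=
  @Efd 1 0 0 (fun=> t_ k (mvvar (inr ord0))) (fun=> mvvar (inl ord0)).

Definition Sigma_triv : set sentence :=
  [set @Identity 2 (mvvar ord0) (mvvar ord_max)].

Definition Sigma_bool : set sentence :=
  [set @Identity 1 (mvmuln 2 (mvvar ord0)) (mvvar ord0)].

Definition Sigma_ (S : set nat) : set sentence := epsilon @` S.

Definition prime_set (S : set nat) : Prop := forall p, S p -> prime p.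

Definition canonical_axioms : set (set sentence) :=
  [set T | [\/ T = Sigma_triv, T = Sigma_bool |
               exists2 S : set nat, prime_set S & T = Sigma_ S]].

Definition is_AE_subclass (K : mvstr -> Prop) : Prop :=
  exists2 Sigma : set sentence, Sigma `<=` is_efd &
    forall A : mvstr, K A <-> (VP A /\ models A Sigma).

Definition AE_subclass : Type := {K : mvstr -> Prop | is_AE_subclass K}.

Definition AE_le (K1 K2 : AE_subclass) : Prop :=
  forall A : mvstr, proj1_sig K1 A -> proj1_sig K2 A.

(* The order of the ordinal sum L1 ⊕ L2, carried by the disjoint union. *)
Definition ordinal_sum_le (d1 d2 : Order.disp_t)
    (L1 : latticeType d1) (L2 : latticeType d2) (x y : L1 + L2) : Prop :=
  match x, y with
  | inl a, inl b => (a <= b)%O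
  | inl _, inr _ => True
  | inr _, inl _ => False
  | inr a, inr b => (a <= b)%O
  end.

Definition order_isomorphic (T T' : Type) (le : T -> T -> Prop)
    (le' : T' -> T' -> Prop) : Prop :=
  exists2 f : T -> T', bijective f & forall x y : T, le x y <-> le' (f x) (f y).

(* Main.v *)
(** Every algebra of V(P) is a subdirect product of perfect chains, that is, of
    chains Γ(Z ×lex G) with G a totally ordered abelian group; on such a chain
    t_p multiplies the G-component by p, so ε_p says that G is p-divisible.
    Unique local solutions of a system of equations glue over the prime spectrum,
    so an EFD-sentence may be tested on the chain quotients.  There a system is a
    Boolean combination of linear inequalities with integer coefficients, and
    Fourier-Motzkin elimination transfers finitely many of these between ordered
    groups.  If the sentence holds in some non-Boolean algebra, its solution for
    integer parameters is therefore unique and rational, and a model that is not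
    p-divisible keeps p out of the denominators.  The coefficients of the linear
    pieces of the solution then only involve those primes p for which every model
    satisfies ε_p, and divisibility by these primes suffices for solvability.
    The chains over the subrings Z[1/p : p in S] of the rationals separate the
    sets Σ_S. *)
Require Import Defs.
From HB Require Import structures.
From mathcomp Require Import all_boot all_order all_algebra.
From mathcomp Require Import boolp classical_sets cardinality.
From mathcomp Require Import zify ring.
Set Implicit Arguments.
Unset Strict Implicit.
Unset Printing Implicit Defensive.
Import Order.TTheory GRing.Theory Num.Theory.
Local Open Scope classical_set_scope.
Local Open Scope mv_scope.

Definition monus {A : mvstr} (x y : A) : A := ¬ ((¬ x) + y).
Notation "x ⊖ y" := (monus x y) (at level 50, left associativity) : mv_scope.
Definition leq_mv {A : mvstr} (x y : A) : Prop := (¬ x) + y = mvone.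
Notation "x ⊑ y" := (leq_mv x y) (at level 70) : mv_scope.

(** * MV-algebras *)

Section MVTheory.
Variables (A : mvstr) (MV : is_MV A).
Implicit Types x y z a b c : A.

Let addA := mvaddA MV.
Let addC := mvaddC MV.
Let add0 := mvadd0 MV.
Let negK := mvnegK MV.

Lemma mvadd0m x : 0 + x = x. Proof. by rewrite addC add0. Qed.
Lemma mvaddm1 x : x + mvone = mvone. Proof. exact: mvadd1 MV x. Qed.
Lemma mvadd1m x : mvone + x = mvone. Proof. by rewrite addC mvaddm1. Qed.
Lemma mvneg1 : ¬ (@mvone A) = 0. Proof. exact: negK. Qed.
Lemma mvneg_inj x y : ¬ x = ¬ y -> x = y.
Proof. by move=> e; rewrite -(negK x) e negK. Qed.

Lemma mvaddNm x : (¬ x) + x = mvone.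
Proof.
have := mvjoin_ax MV x mvone.
by rewrite !mvaddm1 mvneg1 mvadd0m => <-.
Qed.

Lemma mvaddmN x : x + (¬ x) = mvone. Proof. by rewrite addC mvaddNm. Qed.
Lemma mvaddCA x y z : x + (y + z) = y + (x + z).
Proof. by rewrite addA (addC x) -addA. Qed.
Lemma mvaddACA x y z t : (x + y) + (z + t) = (x + z) + (y + t).
Proof. by rewrite -!addA (mvaddCA y). Qed.

Lemma mvsubK_le x y : x ⊑ y -> (y ⊖ x) + x = y.
Proof.
rewrite /leq_mv /monus => h.
by rewrite -(mvjoin_ax MV) h mvneg1 mvadd0m.
Qed.

Lemma mvle_addr x y : x ⊑ x + y.
Proof. by rewrite /leq_mv addA mvaddNm mvadd1m. Qed.
Lemma mvle_addl x y : x ⊑ y + x. Proof. by rewrite addC; exact: mvle_addr. Qed.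
Lemma mvle_refl x : x ⊑ x. Proof. exact: mvaddNm. Qed.
Lemma mvle0m x : 0 ⊑ x. Proof. by rewrite /leq_mv mvadd1m. Qed.
Lemma mvlem1 x : x ⊑ mvone. Proof. exact: mvaddm1. Qed.

Lemma mvle_trans y x z : x ⊑ y -> y ⊑ z -> x ⊑ z.
Proof.
move=> /mvsubK_le <- /mvsubK_le <-; rewrite addA; exact: mvle_addl.
Qed.

Lemma mvle_anti x y : x ⊑ y -> y ⊑ x -> x = y.
Proof.
move=> h1 h2; have := mvjoin_ax MV x y.
by rewrite [(¬ x) + y]h1 [(¬ y) + x]h2 mvneg1 !mvadd0m.
Qed.

Lemma mvle_m0 x : x ⊑ 0 -> x = 0.
Proof. by move=> h; apply: mvle_anti (mvle0m x). Qed.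

Lemma mvle_neg x y : x ⊑ y -> ¬ y ⊑ ¬ x.
Proof. by rewrite /leq_mv negK addC. Qed.
Lemma mvle_negE x y : (¬ x ⊑ ¬ y) = (y ⊑ x).
Proof. by rewrite /leq_mv negK addC. Qed.

Lemma mvsub_leE x y z : (x ⊖ y ⊑ z) = (x ⊑ y + z).
Proof. by rewrite /leq_mv /monus negK addA. Qed.

Lemma mvle_add2l z x y : x ⊑ y -> z + x ⊑ z + y.
Proof. by move=> /mvsubK_le <-; rewrite mvaddCA; exact: mvle_addl. Qed.
Lemma mvle_add2r z x y : x ⊑ y -> x + z ⊑ y + z.
Proof. by rewrite ![_ + z]addC; exact: mvle_add2l. Qed.
Lemma mvle_add x y z t : x ⊑ y -> z ⊑ t -> x + z ⊑ y + t.
Proof. by move=> h k; apply: mvle_trans (mvle_add2l _ k); exact: mvle_add2r. Qed.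

Lemma mvsub_le x y : x ⊖ y ⊑ x.
Proof. by rewrite mvsub_leE; exact: mvle_addl. Qed.
Lemma mvsubmm x : x ⊖ x = 0.
Proof. by rewrite /monus mvaddNm mvneg1. Qed.
Lemma mvsubm0 x : x ⊖ 0 = x.
Proof. by rewrite /monus add0 negK. Qed.
Lemma mvsub0P x y : x ⊑ y <-> x ⊖ y = 0.
Proof.
split=> [h|h]; first by rewrite /monus [_ + y]h mvneg1.
by rewrite /leq_mv -[_ + y]negK [¬ (_ + y)]h.
Qed.
Lemma mvsubNN x y : (¬ x) ⊖ (¬ y) = y ⊖ x.
Proof. by rewrite /monus negK addC. Qed.

Lemma mvjoinE x y : mvjoin x y = (x ⊖ y) + y. Proof. by []. Qed.
Lemma mvjoinC x y : mvjoin x y = mvjoin y x. Proof. exact: mvjoin_ax. Qed.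
Lemma mvle_joinr x y : y ⊑ mvjoin x y. Proof. exact: mvle_addl. Qed.
Lemma mvle_joinl x y : x ⊑ mvjoin x y. Proof. rewrite mvjoinC; exact: mvle_joinr. Qed.
Lemma mvjoin_lub x y z : x ⊑ z -> y ⊑ z -> mvjoin x y ⊑ z.
Proof.
move=> hx hy; rewrite -(mvsubK_le hy) mvjoinE; apply: mvle_add2r.
by rewrite mvsub_leE addC mvsubK_le.
Qed.
Lemma mvleE x y : mvle x y <-> x ⊑ y.
Proof.
split=> [<-|h]; first exact: mvle_joinl.
by rewrite /mvle mvjoinC mvjoinE mvsubK_le.
Qed.

Lemma mvle_meetr x y : mvmeet x y ⊑ y.
Proof. by rewrite -mvle_negE negK; exact: mvle_joinr. Qed.
Lemma mvle_meetl x y : mvmeet x y ⊑ x.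
Proof. by rewrite -mvle_negE negK; exact: mvle_joinl. Qed.
Lemma mvmeet_glb z x y : z ⊑ x -> z ⊑ y -> z ⊑ mvmeet x y.
Proof. by move=> h k; rewrite -mvle_negE negK; apply: mvjoin_lub; rewrite mvle_negE. Qed.
Lemma mvmeetC x y : mvmeet x y = mvmeet y x.
Proof. by rewrite /mvmeet mvjoinC. Qed.
Lemma mvmeet_eqr x y : y ⊑ x -> mvmeet x y = y.
Proof. by move=> h; apply: mvle_anti (mvle_meetr _ _) (mvmeet_glb h (mvle_refl _)). Qed.
Lemma mvmeetE x y : mvmeet x y = y ⊖ (y ⊖ x).
Proof. by rewrite /mvmeet /mvjoin /monus negK [¬ y + _]addC [x + _]addC. Qed.

Lemma mvmeetA x y z : mvmeet x (mvmeet y z) = mvmeet (mvmeet x y) z.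
Proof.
apply: mvle_anti; do ?apply: mvmeet_glb.
- exact: mvle_meetl.
- exact: mvle_trans (mvle_meetr _ _) (mvle_meetl _ _).
- exact: mvle_trans (mvle_meetr _ _) (mvle_meetr _ _).
- exact: mvle_trans (mvle_meetl _ _) (mvle_meetl _ _).
- exact: mvle_trans (mvle_meetl _ _) (mvle_meetr _ _).
- exact: mvle_meetr.
Qed.

Lemma mvaddm_meet c x y : c + mvmeet x y = mvmeet (c + x) (c + y).
Proof.
apply: mvle_anti.
  by apply: mvmeet_glb; apply: mvle_add2l; [exact: mvle_meetl|exact: mvle_meetr].
rewrite -mvsub_leE; apply: mvmeet_glb; rewrite mvsub_leE;
  [exact: mvle_meetl|exact: mvle_meetr].
Qed.

Lemma mvaddmK_meet m c : (m + c) ⊖ m = mvmeet c (¬ m).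
Proof. by rewrite mvmeetE /monus !negK addC. Qed.

Lemma mvsub_meet x y : x ⊖ mvmeet x y = x ⊖ y.
Proof.
apply: mvle_anti; rewrite mvsub_leE.
  rewrite addC mvaddm_meet; apply: mvmeet_glb; first exact: mvle_addl.
  by rewrite addC -mvsub_leE; exact: mvle_refl.
apply: mvle_trans (mvle_add2r _ (mvle_meetr x y)).
by rewrite -mvsub_leE; exact: mvle_refl.
Qed.

Lemma mvprelinear x y : mvmeet (x ⊖ y) (y ⊖ x) = 0.
Proof.
set a := x ⊖ y; set b := y ⊖ x; set m := mvmeet x y.
have xE : m + a = x.
  by rewrite addC /a -mvsub_meet mvsubK_le //; exact: mvle_meetl.
have yE : m + b = y.
  by rewrite addC /b -mvsub_meet mvmeetC mvsubK_le //; exact: mvle_meetr.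
have e : m + mvmeet a b = m by rewrite mvaddm_meet xE yE.
have <- : mvmeet (mvmeet a b) (¬ m) = 0 by rewrite -mvaddmK_meet e mvsubmm.
rewrite [RHS]mvmeetC; apply/esym/mvmeet_eqr; apply: mvle_trans (mvle_meetl _ _) _.
by rewrite /a -mvsub_meet -/m mvle_negE; exact: mvle_addl.
Qed.

Lemma mvmeet_add0 x x' y :
  mvmeet x y = 0 -> mvmeet x' y = 0 -> mvmeet (x + x') y = 0.
Proof.
move=> h h'; set c := mvmeet _ _.
have hc : c ⊑ x.
  rewrite -[x]add0 -mvsub_leE -h'; apply: mvmeet_glb.
    by rewrite mvsub_leE; exact: mvle_meetl.
  exact: mvle_trans (mvsub_le _ _) (mvle_meetr _ _).
by apply: mvle_m0; rewrite -h; apply: mvmeet_glb => //; exact: mvle_meetr.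
Qed.

Lemma mvmulE x y : mvmul x y = x ⊖ ¬ y. Proof. by []. Qed.

Lemma mvsub_tri x y z : x ⊖ z ⊑ (x ⊖ y) + (y ⊖ z).
Proof.
rewrite mvsub_leE addC -addA -/(mvjoin y z).
exact: mvle_trans (mvle_joinl x y) (mvle_add2l _ (mvle_joinl _ _)).
Qed.

Lemma mvsub_add2r x y z : (x + z) ⊖ (y + z) ⊑ x ⊖ y.
Proof.
rewrite mvsub_leE [y + z]addC -addA addC; apply: mvle_add2l.
by rewrite addC; exact: mvle_joinl.
Qed.

Lemma mvmuln0 x : mvmuln 0 x = 0. Proof. by []. Qed.
Lemma mvmulnS k x : mvmuln k.+1 x = x + mvmuln k x.
Proof. by case: k => [|k] //=; rewrite /mvmuln /= add0. Qed.
Lemma mvmulnD k l x : mvmuln (k + l) x = mvmuln k x + mvmuln l x.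
Proof. by elim: k => [|k IH]; rewrite ?mvadd0m // addSn !mvmulnS IH addA. Qed.
Lemma mvmuln_addm k x y : mvmuln k (x + y) = mvmuln k x + mvmuln k y.
Proof. by elim: k => [|k IH]; rewrite ?mvmuln0 ?add0 // !mvmulnS IH mvaddACA. Qed.
Lemma mvmeet_muln0 k x y : mvmeet x y = 0 -> mvmeet (mvmuln k x) y = 0.
Proof.
move=> h; elim: k => [|k IH]; last by rewrite mvmulnS; exact: mvmeet_add0.
by apply: mvle_m0; exact: mvle_meetl.
Qed.

Definition mvdist x y := (x ⊖ y) + (y ⊖ x).
Lemma mvadd_eq0 x y : x + y = 0 -> x = 0 /\ y = 0.
Proof.
by move=> e; split; apply: mvle_m0; rewrite -e; [exact: mvle_addr|exact: mvle_addl].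
Qed.
Lemma mvdistP x y : mvdist x y = 0 <-> x = y.
Proof.
split=> [/mvadd_eq0[]|->]; last by rewrite /mvdist mvsubmm add0.
by rewrite -!mvsub0P; exact: mvle_anti.
Qed.

End MVTheory.
Arguments mvdist {A} x y.

Section Hom.
Variables (A B : mvstr) (f : A -> B) (hf : is_hom f).

Lemma homD x y : f (x + y) = f x + f y. Proof. by case: hf. Qed.
Lemma homN x : f (¬ x) = ¬ (f x). Proof. by case: hf. Qed.
Lemma hom0 : f 0 = 0. Proof. by case: hf. Qed.
Lemma hom1 : f mvone = mvone. Proof. by rewrite /mvone homN hom0. Qed.
Lemma hom_sub x y : f (x ⊖ y) = f x ⊖ f y.
Proof. by rewrite /monus !(homD, homN). Qed.
Lemma hom_mul x y : f (mvmul x y) = mvmul (f x) (f y).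
Proof. by rewrite /mvmul !(homD, homN). Qed.
Lemma hom_join x y : f (mvjoin x y) = mvjoin (f x) (f y).
Proof. by rewrite /mvjoin !(homD, homN). Qed.
Lemma hom_meet x y : f (mvmeet x y) = mvmeet (f x) (f y).
Proof. by rewrite /mvmeet homN hom_join !homN. Qed.
Lemma hom_dist x y : f (mvdist x y) = mvdist (f x) (f y).
Proof. by rewrite /mvdist homD !hom_sub. Qed.
Lemma hom_muln k x : f (mvmuln k x) = mvmuln k (f x).
Proof.
case: k => [|k]; first exact: hom0.
by rewrite /mvmuln !iteropS; elim: k => //= k IH; rewrite homD IH.
Qed.
Lemma hom_exp k x : f (mvexp x k) = mvexp (f x) k.
Proof.
case: k => [|k]; first exact: hom1.
by rewrite /mvexp !iteropS; elim: k => //= k IH; rewrite hom_mul IH.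
Qed.
Lemma hom_t k x : f (t_ k x) = t_ k (f x).
Proof. by rewrite /t_ hom_join hom_meet homN !(hom_muln, hom_exp). Qed.
Lemma hom_eval V (e : V -> A) t : f (eval e t) = eval (f \o e) t.
Proof.
by elim: t => [v|s IHs t IHt|t IHt|] //=; rewrite ?(homD, homN, hom0) ?IHs ?IHt.
Qed.
End Hom.

Lemma eval_ext (A : mvstr) V (e e' : V -> A) t :
  (forall v, e v = e' v) -> eval e t = eval e' t.
Proof.
by move=> h; elim: t => [v|s IHs t IHt|t IHt|] //=; rewrite ?IHs ?IHt ?h.
Qed.

Lemma hom_term (A : mvstr) V (e : V -> A) : @is_hom (term_mvstr V) A (eval e).
Proof. by split. Qed.

Lemma comp_hom (A B C : mvstr) (f : A -> B) (g : B -> C) :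
  is_hom f -> is_hom g -> is_hom (g \o f).
Proof.
move=> hf hg.
by split=> *; rewrite /= ?(homD hf, homN hf, hom0 hf) ?(homD hg, homN hg, hom0 hg).
Qed.

(* The equation [2x² = (2x)²] axiomatizes V(P) among MV-algebras; only the
   inclusion of V(P) is needed. *)
Record is_MVP (A : mvstr) : Prop := IsMVP {
  MVP_MV : is_MV A;
  MVP_sq : forall x : A, mvmul x x + mvmul x x = mvmul (x + x) (x + x) }.

Lemma MVP_surj (A B : mvstr) (f : A -> B) : is_hom f ->
  (forall b, exists a, f a = b) -> is_MVP A -> is_MVP B.
Proof.
move=> hf sf [[h1 h2 h3 h4 h5 h6] h7].
have E := (homD hf, homN hf, hom0 hf).
split; first split.
- by move=> x y z; have [a <-] := sf x; have [b <-] := sf y; have [c <-] := sf z; rewrite -!E h1.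
- by move=> x y; have [a <-] := sf x; have [b <-] := sf y; rewrite -!E h2.
- by move=> x; have [a <-] := sf x; rewrite -(hom0 hf) -E h3.
- by move=> x; have [a <-] := sf x; rewrite -!E h4.
- by move=> x; have [a <-] := sf x; rewrite -(hom0 hf) -!E h5.
- by move=> x y; have [a <-] := sf x; have [b <-] := sf y; rewrite -!E h6.
- by move=> x; have [a <-] := sf x; rewrite -!(homD hf) -!(hom_mul hf) -(homD hf) h7.
Qed.

Lemma MVP_inj (A B : mvstr) (f : A -> B) : is_hom f -> injective f ->
  is_MVP B -> is_MVP A.
Proof.
move=> hf fi [[h1 h2 h3 h4 h5 h6] h7].
have E := (homD hf, homN hf, hom0 hf).
split; first split; move=> *; apply: fi; rewrite ?(hom_mul hf, E) //.
Qed.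

Lemma MVP_prod I (A : I -> mvstr) :
  (forall i, is_MVP (A i)) -> is_MVP (prod_mvstr A).
Proof.
move=> h; split; first split; move=> *; apply: functional_extensionality_dep => i /=.
- exact: mvaddA (MVP_MV (h i)) _ _ _.
- exact: mvaddC (MVP_MV (h i)) _ _.
- exact: mvadd0 (MVP_MV (h i)) _.
- exact: mvnegK (MVP_MV (h i)) _.
- exact: mvadd1 (MVP_MV (h i)) _.
- exact: mvjoin_ax (MVP_MV (h i)) _ _.
- exact: MVP_sq (h i) _.
Qed.

Lemma MVP_variety : is_variety is_MVP.
Proof.
by split; [exact: MVP_surj|exact: MVP_inj|exact: MVP_prod].
Qed.

Lemma ideal_separation (A : mvstr) (I F : set A) :
  is_ideal I -> (forall a, F a -> ~ I a) ->
  exists P : set A, [/\ is_ideal P, I `<=` P, (forall a, F a -> ~ P a) &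
    forall J, is_ideal J -> P `<=` J -> (forall a, F a -> ~ J a) -> J `<=` P].
Proof.
move=> hI hF.
pose Q (X : set A) := is_ideal (I `|` X) /\ (forall a, F a -> ~ (I `|` X) a).
have [G GQ tot|X [[hX FX] mX]] := @Zorn_bigcup A Q.
  have [->|/set0P[X0 GX0]] := eqVneq G set0.
    by rewrite bigcup_set0 /Q setU0.
  split; last first.
    move=> a Fa [|[X GX Xa]]; first exact: hF.
    by have [_ h] := GQ X GX; apply: (h _ Fa); right.
  have ext X Y : G X -> G Y -> exists Z, [/\ G Z, X `<=` Z & Y `<=` Z].
    by move=> GX GY; have [h|h] := tot _ _ GX GY; [exists Y; split|exists X; split].
  have in_ a : (I `|` \bigcup_(X in G) X) a -> exists2 X, G X & (I `|` X) a.
    by case=> [Ia|[X GX Xa]]; [exists X0 => //; left|exists X => //; right].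
  split.
  - by have [i Ii] := ideal_nonempty hI; exists i; left.
  - move=> x y xy /in_[X GX XX].
    have [hX _] := GQ _ GX; have [Ix|Xx] := ideal_down hX xy XX; first by left.
    by right; exists X.
  - move=> x y /in_[X GX XX] /in_[Y GY YY].
    have [Z [GZ XZ YZ]] := ext _ _ GX GY.
    have [hZ _] := GQ _ GZ.
    case: (@ideal_add _ _ hZ x y).
    + by case: XX; [left|move/XZ; right].
    + by case: YY; [left|move/YZ; right].
    + by left.
    + by right; exists Z.
exists (I `|` X); split => // J hJ PJ FJ a Ja.
apply: contrapT => na.
have IJ : I `|` J = J by rewrite setUidr // => b Ib; apply: PJ; left.
apply: (mX J); last by rewrite /Q IJ.
split; first by move=> b Xb; apply: PJ; right.
by move=> JX; apply: na; right; exact: JX.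
Qed.

Lemma perfect_MVP (A : mvstr) : perfect A -> is_MVP A.
Proof.
move=> [MV _ AE]; split => //.
(* If [b * b] is not 0 then its annihilator is a proper ideal containing
   [¬ (b + b)], so a maximal ideal above it misses [b]. *)
have sq0 b : mvrad A b -> mvmul b b = 0.
  move=> rb; apply: contrapT => nz.
  set c := mvmul b b in nz.
  pose I : set A := [set x | mvmeet x c = 0].
  have hI : is_ideal I.
    split.
    - by exists 0; apply: mvle_m0 => //; exact: mvle_meetl.
    - move=> x y /(mvleE MV) xy; rewrite /I /= => h; apply: mvle_m0 => //.
      rewrite -h; apply: mvmeet_glb => //; last exact: mvle_meetr.
      by refine (mvle_trans MV (mvle_meetl MV _ _) xy).
    - by move=> x y; exact: mvmeet_add0.
  have I1 : ~ I mvone.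
    rewrite /I /= (mvmeet_eqr MV) //; exact: mvlem1.
  have Inb : I (¬ (b + b)).
    have -> : ¬ (b + b) = (¬ b) ⊖ b by rewrite /monus mvnegK.
    by rewrite /I /= mvmeetC // /c mvmulE; exact: mvprelinear.
  have [a ->|P [hP IP FP mP]] := ideal_separation (F := [set mvone]) hI.
    exact: I1.
  have maxP : is_maximal_ideal P.
    split => //; first by move=> e; apply: (FP mvone) => //; rewrite e.
    move=> J hJ PJ nJ; apply/seteqP; split => //; apply: mP => // _ -> J1.
    apply: nJ; rewrite predeqE => x; split=> // _.
    by apply: (ideal_down hJ _ J1); apply/mvleE => //; exact: mvlem1.
  apply: (FP mvone) => //.
  rewrite -(mvaddmN MV (b + b)); apply: (ideal_add hP); last exact: IP.
  by apply: (ideal_add hP); exact: rb.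
have dbl b : mvrad A b -> mvrad A (b + b).
  by move=> rb I mI; have [hI _ _] := mI; apply: (ideal_add hI); exact: rb.
move=> x; have : (mvrad A `|` (@mvneg A @` mvrad A)) x by rewrite -AE.
case=> [rx|[b rb <-]].
  by rewrite (sq0 _ rx) (sq0 _ (dbl _ rx)) (mvadd0 MV).
rewrite /mvmul !(mvnegK MV) -[_ + (¬ (b + b))](mvnegK MV) -/(mvmul _ _).
rewrite (sq0 _ (dbl _ rb)).
have -> : (¬ b) + ¬ b = mvone.
  by rewrite -[LHS](mvnegK MV) -/(mvmul _ _) (sq0 _ rb).
by rewrite (mvneg1 MV) (mvadd0 MV).
Qed.

Lemma VP_MVP (A : mvstr) : VP A -> is_MVP A.
Proof. by move=> h; apply: h MVP_variety _; exact: perfect_MVP. Qed.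

(** * Perfect chains and ordered groups *)

Section Quotient.
Variables (T : Type) (E : T -> T -> Prop).
Hypotheses (Er : forall x, E x x) (Es : forall x y, E x y -> E y x)
  (Et : forall y x z, E x y -> E y z -> E x z).

Definition quot : Type := {X : set T | exists x, X = E x}.
Definition quot_pi (x : T) : quot := exist _ (E x) (ex_intro _ x erefl).

Lemma quot_pi_surj (q : quot) : exists x, quot_pi x = q.
Proof.
by case: q => X [x eX]; exists x; subst X.
Qed.

Lemma quot_piP x y : quot_pi x = quot_pi y <-> E x y.
Proof.
split=> [/(congr1 (@proj1_sig _ _)) /= ->|h]; first exact: Er.
apply: eq_exist; rewrite predeqE => z; split=> k; apply: Et k => //; exact: Es.
Qed.

Definition quot_repr (q : quot) : T := projT1 (cid (quot_pi_surj q)).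
Lemma quot_reprK q : quot_pi (quot_repr q) = q.
Proof. by rewrite /quot_repr; case: cid. Qed.
End Quotient.

Lemma quotient_alg (A : mvstr) (E : A -> A -> Prop) :
  (forall x, E x x) -> (forall x y, E x y -> E y x) ->
  (forall y x z, E x y -> E y z -> E x z) ->
  (forall x x' y y', E x x' -> E y y' -> E (x + y) (x' + y')) ->
  (forall x x', E x x' -> E (¬ x) (¬ x')) ->
  exists (B : mvstr) (f : A -> B),
    [/\ is_hom f, forall b, exists a, f a = b & forall x y, f x = f y <-> E x y].
Proof.
move=> Er Es Et ED EN.
pose pi := @quot_pi A E; pose r := @quot_repr A E.
have rK q : pi (r q) = q := quot_reprK q.
have piP x y : pi x = pi y <-> E x y by exact: quot_piP.
have Er_ x : E (r (pi x)) x by apply/piP.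
exists (@MVStr (quot E) (fun p q => pi (r p + r q)) (fun p => pi (¬ (r p))) (pi 0)), pi.
split => //; last exact: quot_pi_surj.
split => //= [x y|x]; apply/piP.
  by apply: ED; apply: Es.
by apply: EN; apply: Es.
Qed.

Section ChangAlgebra.
Variables (G : zmodType) (P : pred G).

Definition chang_add (x y : bool * G) : bool * G :=
  let m u := if P u then u else 0%R in
  match x.1, y.1 with
  | false, false => (false, x.2 + y.2)%R
  | false, true => (true, m (y.2 - x.2)%R)
  | true, false => (true, m (x.2 - y.2)%R)
  | true, true => (true, 0%R)
  end.

(* The perfect MV-algebra of the ordered group with nonnegative cone [P],
   carried by the pairs with second component in [P]: [(false, g)] is the
   infinitesimal [g] and [(true, g)] is [1 - g]. *)
Definition chang : mvstr :=
  @MVStr (bool * G) chang_add (fun x => (~~ x.1, x.2)) (false, 0%R).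
End ChangAlgebra.

Record osp : Type := Osp {
  og :> zmodType;
  opos : pred og;
  oposD : forall x y, opos x -> opos y -> opos (x + y)%R;
  opos_anti : forall x, opos x -> opos (- x)%R -> x = 0%R;
  opos_total : forall x, opos x || opos (- x)%R }.

Arguments opos {o} _.

Section OspTheory.
Local Open Scope ring_scope.
Variable G : osp.
Implicit Types x y : G.

Lemma opos0 : opos (0 : G).
Proof. by have := opos_total (0 : G); rewrite oppr0 orbb. Qed.
Lemma opos_muln x n : opos x -> opos (x *+ n).
Proof.
by move=> h; elim: n => [|n IH]; [exact: opos0|rewrite mulrS; exact: oposD].
Qed.
Lemma oposN x : ~~ opos x -> opos (- x).
Proof. by have := opos_total x; case: (opos x). Qed.
Lemma opos_mulnE x n : (0 < n)%N -> opos (x *+ n) = opos x.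
Proof.
move=> n0; apply/idP/idP => [|/opos_muln//].
apply: contraLR => h; have h' := oposN h.
have h2 : opos (- (x *+ n)) by rewrite -mulNrn; exact: opos_muln.
apply/negP => h3; move: h.
have e : x *+ n = 0 by exact: opos_anti.
case: n n0 h2 h3 e => // n _ _ _; rewrite mulrSr => e.
have -> : x = (- x) *+ n by apply/eqP; rewrite mulNrn -addr_eq0 addrC e.
by rewrite opos_muln.
Qed.
Lemma mulrn_oeq0 x n : (0 < n)%N -> (x *+ n == 0) = (x == 0).
Proof.
move=> n0; apply/eqP/eqP => [e|->]; last by rewrite mul0rn.
apply: opos_anti; rewrite -(opos_mulnE _ n0) ?mulNrn e ?oppr0; exact: opos0.
Qed.
Lemma mulrn_oinj x y n : (0 < n)%N -> x *+ n = y *+ n -> x = y.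
Proof.
move=> n0 e; apply/eqP; rewrite -subr_eq0 -(mulrn_oeq0 _ n0) mulrnBl e subrr //.
Qed.
Lemma oposB_anti x y : opos (x - y) -> opos (y - x) -> x = y.
Proof.
by move=> h k; apply/eqP; rewrite -subr_eq0; apply/eqP/opos_anti => //; rewrite opprB.
Qed.
Lemma oposD_eq0 x y : opos x -> opos y -> x + y = 0 -> x = 0.
Proof.
move=> hx hy e; apply: opos_anti => //.
by have -> : - x = y by apply/eqP; rewrite eq_sym -addr_eq0 addrC e.
Qed.
End OspTheory.

(* The quotients of [A] by prime ideals, up to isomorphism. *)
Record is_rep (A : mvstr) (G : osp) (f : A -> chang (@opos G)) : Prop := IsRep {
  rep_hom : is_hom f;
  rep_pos : forall a, opos (f a).2;
  rep_onto : forall y : chang (@opos G), opos y.2 -> exists a, f a = y }.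

Lemma sval_inj T (P : T -> Prop) (a b : {x | P x}) : sval a = sval b -> a = b.
Proof. by case: a b => [a ha] [b hb] /= e; apply: eq_exist. Qed.

Record is_chain (C : mvstr) : Prop := IsChain {
  chain_MVP : is_MVP C;
  chain_total : forall x y : C, x ⊑ y \/ y ⊑ x;
  chain_nontrivial : @mvzero C <> mvone }.

Section ChainGroup.
Variables (C : mvstr) (HC : is_chain C).
Let MV : is_MV C := MVP_MV (chain_MVP HC).
Implicit Types x y z : C.

Definition infin {A : mvstr} (x : A) : Prop := x ⊑ ¬ x.

Lemma infin0 : infin (0 : C). Proof. exact: mvle0m. Qed.
Lemma infin_down x y : x ⊑ y -> infin y -> infin x.
Proof.
move=> h k; apply: (mvle_trans MV h); apply: (mvle_trans MV k); exact: mvle_neg.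
Qed.
Lemma infin_sq x : infin x <-> mvmul x x = 0.
Proof.
rewrite /infin /leq_mv /mvmul; split=> [->|h]; first exact: mvneg1.
by apply: (mvneg_inj MV); rewrite h mvneg1.
Qed.
Lemma infin_dbl x : infin x -> infin (x + x).
Proof.
move=> /infin_sq h; apply/infin_sq.
by rewrite -(MVP_sq (chain_MVP HC)) h mvadd0.
Qed.
Lemma infinD x y : infin x -> infin y -> infin (x + y).
Proof.
move=> hx hy; have [h|h] := chain_total HC x y.
  by apply: infin_down (infin_dbl hy); exact: mvle_add2r.
by apply: infin_down (infin_dbl hx); exact: mvle_add2l.
Qed.
Lemma infin_sub x y : infin x -> infin (x ⊖ y).
Proof. by apply: infin_down; exact: mvsub_le. Qed.
Lemma infinVN x : infin x \/ infin (¬ x).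
Proof.
by rewrite /infin (mvnegK MV); exact: chain_total.
Qed.
Lemma infin_leN x y : infin x -> infin y -> x ⊑ ¬ y.
Proof.
move=> hx hy; have [h|h] := chain_total HC x y; first exact (mvle_trans MV h hy).
by apply: (mvle_trans MV hx); exact: mvle_neg.
Qed.
Lemma infinN_false x : infin x -> infin (¬ x) -> False.
Proof.
rewrite {2}/infin (mvnegK MV) => h /(mvle_anti MV h) e.
have : infin (@mvone C) by rewrite -(mvaddNm MV x) -e; exact: infin_dbl.
rewrite /infin mvneg1 // => /(mvle_m0 MV) k; exact: (chain_nontrivial HC).
Qed.
Lemma infin_addK x y : infin x -> infin y -> (x + y) ⊖ x = y.
Proof.
move=> hx hy; rewrite mvaddmK_meet // mvmeetC // mvmeet_eqr //; exact: infin_leN.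
Qed.
Lemma infin_inj x y z : infin x -> infin y -> infin z -> x + y = x + z -> y = z.
Proof. by move=> hx hy hz e; rewrite -(infin_addK hx hy) e infin_addK. Qed.

Definition chain_rad : Type := {x : C | infin x}.
Definition radD (a b : chain_rad) : chain_rad :=
  exist _ (sval a + sval b) (infinD (svalP a) (svalP b)).
Definition rad0 : chain_rad := exist _ 0 infin0.
Definition rad_eqv (p q : chain_rad * chain_rad) : Prop :=
  sval p.1 + sval q.2 = sval q.1 + sval p.2.

Lemma rad_eqv_refl p : rad_eqv p p. Proof. by []. Qed.
Lemma rad_eqv_sym p q : rad_eqv p q -> rad_eqv q p. Proof. exact: esym. Qed.
Lemma rad_eqv_trans q p r : rad_eqv p q -> rad_eqv q r -> rad_eqv p r.
Proof.
case: p q r => [[a ha] [a' ha']] [[b hb] [b' hb']] [[c hc] [c' hc']].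
rewrite /rad_eqv /= => e f; apply: (@infin_inj b'); rewrite ?infinD //.
- exact: infinD.
- exact: infinD.
rewrite (mvaddA MV) (mvaddC MV b') e -(mvaddA MV) (mvaddC MV a') (mvaddA MV) f.
by rewrite -(mvaddA MV) (mvaddCA MV).
Qed.

Lemma radDE p q r s : rad_eqv p q -> rad_eqv r s ->
  rad_eqv (radD p.1 r.1, radD p.2 r.2) (radD q.1 s.1, radD q.2 s.2).
Proof.
by rewrite /rad_eqv /= => e f; rewrite (mvaddACA MV) e f (mvaddACA MV).
Qed.
Lemma radDC (a b : chain_rad) : radD a b = radD b a.
Proof. by apply: sval_inj; rewrite /= mvaddC. Qed.
Lemma radDA (a b c : chain_rad) : radD a (radD b c) = radD (radD a b) c.
Proof. by apply: sval_inj; rewrite /= mvaddA. Qed.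
Lemma rad0D (a : chain_rad) : radD rad0 a = a.
Proof. by apply: sval_inj; rewrite /= mvadd0m. Qed.

Definition chain_group : Type := quot rad_eqv.
Let pi : chain_rad * chain_rad -> chain_group := @quot_pi _ rad_eqv.
Let rep : chain_group -> chain_rad * chain_rad := @quot_repr _ rad_eqv.
Let piP p q : pi p = pi q <-> rad_eqv p q.
Proof.
by apply: quot_piP; [exact: rad_eqv_refl|exact: rad_eqv_sym|exact: rad_eqv_trans].
Qed.
Let repP p : rad_eqv (rep (pi p)) p.
Proof. by apply/piP; exact: quot_reprK. Qed.
Let piW (K : chain_group -> Prop) : (forall p, K (pi p)) -> forall q, K q.
Proof. by move=> h q; rewrite -(quot_reprK q); exact: h. Qed.

Definition cgD (p q : chain_group) : chain_group :=
  pi (radD (rep p).1 (rep q).1, radD (rep p).2 (rep q).2).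
Definition cgN (p : chain_group) : chain_group := pi ((rep p).2, (rep p).1).
Definition cg0 : chain_group := pi (rad0, rad0).

Lemma cgDE p q : cgD (pi p) (pi q) = pi (radD p.1 q.1, radD p.2 q.2).
Proof. by apply/piP; apply: radDE; exact: repP. Qed.
Lemma cgNE p : cgN (pi p) = pi (p.2, p.1).
Proof.
apply/piP; have := repP p; rewrite /rad_eqv /=.
by rewrite ![sval _.2 + _](mvaddC MV) => ->.
Qed.
Lemma cgDA : associative cgD.
Proof.
elim/piW => p; elim/piW => q; elim/piW => r.
by rewrite !cgDE /= !radDA.
Qed.
Lemma cgDC : commutative cgD.
Proof.
by elim/piW => p; elim/piW => q; rewrite !cgDE radDC [in X in pi (_, X)]radDC.
Qed.
Lemma cg0D : left_id cg0 cgD.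
Proof. by elim/piW => -[a b]; rewrite cgDE /= !rad0D. Qed.
Lemma cgND : left_inverse cg0 cgN cgD.
Proof.
elim/piW => -[a b]; rewrite cgNE cgDE; apply/piP; rewrite /rad_eqv /=.
by rewrite !(mvadd0 MV) (mvadd0m MV) (mvaddC MV).
Qed.

HB.instance Definition _ := gen_eqMixin chain_group.
HB.instance Definition _ := gen_choiceMixin chain_group.
HB.instance Definition _ := GRing.isZmodule.Build chain_group cgDA cgDC cg0D cgND.

Definition cg_pos : pred chain_group := fun p => `[< exists a, p = pi (a, rad0) >].
Definition cg_in (a : chain_rad) : chain_group := pi (a, rad0).

Lemma cg_inD a b : cg_in (radD a b) = (cg_in a + cg_in b)%R.
Proof. by rewrite [RHS]cgDE /= rad0D. Qed.
Lemma cg_in_inj a b : cg_in a = cg_in b -> sval a = sval b.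
Proof. by move/piP; rewrite /rad_eqv /= !(mvadd0 MV). Qed.

Lemma cg_posP p : reflect (exists a, p = cg_in a) (cg_pos p).
Proof. exact: asboolP. Qed.
Lemma cg_posD p q : cg_pos p -> cg_pos q -> cg_pos (p + q)%R.
Proof.
by move=> /cg_posP[a ->] /cg_posP[b ->]; apply/cg_posP; exists (radD a b); rewrite cg_inD.
Qed.
Lemma cg_pos_anti p : cg_pos p -> cg_pos (- p)%R -> p = 0%R.
Proof.
move=> /cg_posP[a ->] /cg_posP[b e].
have : cg_in (radD a b) = cg_in rad0 by rewrite cg_inD -e subrr.
move/cg_in_inj => /= /(mvadd_eq0 MV)[a0 _].
by apply/piP; rewrite /rad_eqv /= a0.
Qed.
Lemma cg_sub (a b : chain_rad) : sval b ⊑ sval a ->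
  exists2 c : chain_rad, pi (a, b) = cg_in c & sval c = sval a ⊖ sval b.
Proof.
move=> h; exists (exist _ (sval a ⊖ sval b) (infin_sub _ (svalP a))) => //.
by apply/piP; rewrite /rad_eqv /= (mvadd0 MV) mvsubK_le.
Qed.
Lemma cg_pos_total p : cg_pos p || cg_pos (- p)%R.
Proof.
elim/piW: p => -[a b]; have [h|h] := chain_total HC (sval a) (sval b).
  apply/orP; right; rewrite [(- _)%R]cgNE; have [c -> _] := cg_sub h.
  by apply/cg_posP; exists c.
by apply/orP; left; have [c -> _] := cg_sub h; apply/cg_posP; exists c.
Qed.

Definition chain_osp : osp := Osp cg_posD cg_pos_anti cg_pos_total.

Lemma cg_inB a b : (cg_in a - cg_in b)%R = pi (a, b).
Proof.
by rewrite [(- _)%R]cgNE [LHS]cgDE /= rad0D radDC rad0D.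
Qed.

Definition chain_side (x : C) : bool := ~~ `[< infin x >].
Lemma chain_side_rad x : infin (if chain_side x then ¬ x else x).
Proof.
by rewrite /chain_side; case: asboolP => //= h; case: (infinVN x).
Qed.
Definition chain_emb (x : C) : chang cg_pos :=
  (chain_side x, cg_in (exist _ _ (chain_side_rad x))).

Lemma chain_emb_inf x (h : infin x) : chain_emb x = (false, cg_in (exist _ x h)).
Proof.
rewrite /chain_emb; have e : chain_side x = false by rewrite /chain_side asboolT.
congr (_, cg_in _) => //; apply: sval_inj; by rewrite /= e.
Qed.
Lemma chain_emb_coinf x (h : infin (¬ x)) :
  chain_emb x = (true, cg_in (exist _ (¬ x) h)).
Proof.
rewrite /chain_emb.
have e : chain_side x = true.
  by rewrite /chain_side asboolF // => k; exact: infinN_false k h.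
congr (_, cg_in _) => //; apply: sval_inj; by rewrite /= e.
Qed.

Lemma chain_emb_mix x c (hx : infin x) (hc : infin (¬ c)) :
  chain_emb (x + c) = chain_emb x + chain_emb c.
Proof.
rewrite (chain_emb_inf hx) (chain_emb_coinf hc) /=.
have k : infin (¬ (x + c)).
  by apply: infin_down hc; apply: mvle_neg => //; exact: mvle_addl.
rewrite (chain_emb_coinf k) /chang_add /= cg_inB.
congr (_, _).
have sE : sval (exist infin (¬ (x + c)) k) = (¬ c) ⊖ x.
  by rewrite /= /monus (mvnegK MV) (mvaddC MV).
have [h|h] := chain_total HC x (¬ c).
  have [d ed sd] := @cg_sub (exist _ _ hc) (exist _ _ hx) h.
  rewrite ed; have -> : cg_pos (cg_in d) by apply/cg_posP; exists d.
  by congr cg_in; apply: sval_inj; rewrite sd.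
set p := pi (_, _).
have -> : (if cg_pos p then p else 0%R) = 0%R.
  case: ifP => // pp; apply: cg_pos_anti => //.
  have [d ed _] := @cg_sub (exist _ _ hx) (exist _ _ hc) h.
  by rewrite [(- _)%R]cgNE /= ed; apply/cg_posP; exists d.
apply/piP; rewrite /rad_eqv [sval _]sE /=.
by rewrite (iffLR (mvsub0P MV _ _) h).
Qed.

Lemma chain_emb_hom : is_hom chain_emb.
Proof.
split.
- move=> x y.
  have [hx|hx] := infinVN x; have [hy|hy] := infinVN y.
  + rewrite (chain_emb_inf hx) (chain_emb_inf hy) (chain_emb_inf (infinD hx hy)) /=.
    by rewrite /chang_add /= -cg_inD; congr (_, cg_in _); apply: sval_inj.
  + exact: chain_emb_mix.
  + rewrite (mvaddC MV) chain_emb_mix //=.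
    by rewrite (chain_emb_inf hy) (chain_emb_coinf hx).
  + have e1 : x + y = mvone.
      by have := infin_leN hx hy; rewrite /leq_mv !(mvnegK MV).
    have k : infin (¬ (x + y)) by rewrite e1 mvneg1 //; exact: infin0.
    rewrite (chain_emb_coinf k) (chain_emb_coinf hx) (chain_emb_coinf hy) /=.
    rewrite /chang_add /=; congr (_, _).
    by apply/piP; rewrite /rad_eqv /= e1 mvneg1.
- move=> x; have [hx|hx] := infinVN x.
    have hx' : infin (¬ (¬ x)) by rewrite mvnegK.
    rewrite (chain_emb_inf hx) (chain_emb_coinf hx') /=.
    by congr (_, cg_in _); apply: sval_inj; rewrite /= mvnegK.
  rewrite (chain_emb_coinf hx) (chain_emb_inf hx) /=.
  by [].
- rewrite (chain_emb_inf infin0) //=.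
Qed.

Lemma chain_emb_inj x : chain_emb x = 0 -> x = 0.
Proof.
have [hx|hx] := infinVN x; last by rewrite (chain_emb_coinf hx).
rewrite (chain_emb_inf hx) => e.
exact: (@cg_in_inj (exist _ x hx) rad0 (congr1 snd e)).
Qed.

Lemma chain_emb_onto (y : chang cg_pos) : cg_pos y.2 -> exists x, chain_emb x = y.
Proof.
case: y => -[] g /= /cg_posP[[x hx] ->]; last by exists x; exact: chain_emb_inf.
have hx' : infin (¬ (¬ x)) by rewrite mvnegK.
exists (¬ x); rewrite (chain_emb_coinf hx'); congr (_, cg_in _).
by apply: sval_inj; rewrite /= mvnegK.
Qed.

Lemma chain_emb_pos x : cg_pos (chain_emb x).2.
Proof. by apply/cg_posP; eexists. Qed.
End ChainGroup.

Lemma chain_rep (C : mvstr) : is_chain C ->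
  exists (G : osp) (f : C -> chang (@opos G)), is_rep f /\ forall x, f x = 0 -> x = 0.
Proof.
move=> HC; exists (chain_osp HC), (@chain_emb C HC); split; last exact: chain_emb_inj.
by split; [exact: chain_emb_hom|exact: chain_emb_pos|exact: chain_emb_onto].
Qed.

Lemma rep_separation (A : mvstr) (I F : set A) :
  is_MVP A -> is_ideal I -> F !=set0 ->
  (forall a b, F a -> F b -> F (mvmeet a b)) -> (forall a, F a -> ~ I a) ->
  exists (G : osp) (f : A -> chang (@opos G)),
    [/\ is_rep f, forall a, I a -> f a = 0 & forall a, F a -> f a <> 0].
Proof.
move=> HA hI [a0 Fa0] Fm FI; have MV := MVP_MV HA.
have [P [hP IP FP mP]] := ideal_separation hI FI.
have P0 : P 0.
  have [i Pi] := ideal_nonempty hP.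
  by apply: (ideal_down hP _ Pi); apply/mvleE => //; exact: mvle0m.
have Pd x y : x ⊑ y -> P y -> P x.
  by move=> /(mvleE MV) h; exact: (ideal_down hP h).
have Pm n x : P x -> P (mvmuln n x).
  move=> Px; elim: n => [//|n IH]; rewrite mvmulnS //.
  exact: (ideal_add hP).
have big x : ~ P x -> exists c n p, [/\ F c, P p & c ⊑ mvmuln n x + p].
  move=> nPx; apply: contrapT => no.
  apply: nPx; apply: (mP [set a | exists n p, P p /\ a ⊑ mvmuln n x + p]).
  - split.
    + by exists 0, 0%N, 0; split => //; exact: mvle0m.
    + move=> a b /(mvleE MV) ab [n [p [Pp h]]]; exists n, p; split => //.
      exact (mvle_trans MV ab h).
    + move=> a b [n [p [Pp h]]] [m [q [Pq k]]]; exists (n + m)%N, (p + q); split.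
        exact: (ideal_add hP).
      by rewrite (mvmulnD MV) (mvaddACA MV); exact: mvle_add.
  - move=> p Pp; exists 0%N, p; split => //; exact: mvle_addl.
  - move=> a Fa [n [p [Pp h]]]; apply: no; by exists a, n, p.
  - exists 1%N, 0; split => //; exact: mvle_addr.
(* An ideal maximal among those avoiding a meet-closed set is prime. *)
have prime x y : mvmeet x y = 0 -> P x \/ P y.
  move=> xy0; apply: contrapT => /not_orP[/big[c [n [p [Fc Pp h]]]] /big[d [m [q [Fd Pq k]]]]].
  apply: (FP (mvmeet c d)); first exact: Fm.
  apply: (Pd _ (p + q)); last exact: (ideal_add hP).
  rewrite -[p + q](mvadd0 MV) -(mvsub_leE MV).
  have <- : mvmeet (mvmuln n x) (mvmuln m y) = 0.
    by rewrite mvmeet_muln0 // mvmeetC // mvmeet_muln0 // mvmeetC.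
  apply: mvmeet_glb => //; rewrite mvsub_leE //.
    apply: (mvle_trans MV (mvle_meetl MV _ _)); apply: (mvle_trans MV h).
    rewrite (mvaddC MV) -(mvaddA MV); apply: mvle_add2l => //.
    exact: mvle_addl.
  apply: (mvle_trans MV (mvle_meetr MV _ _)); apply: (mvle_trans MV k).
  by rewrite (mvaddC MV) (mvaddC MV p) -(mvaddA MV); apply: mvle_add2l => //; exact: mvle_addl.
pose E a b := P (a ⊖ b) /\ P (b ⊖ a).
have [|||||C [g [hg sg gE]]] := @quotient_alg A E.
- by move=> x; rewrite /E mvsubmm.
- by move=> x y [].
- move=> y x z [h1 h2] [h3 h4]; split.
    apply: (Pd _ _ (mvsub_tri MV x y z)); exact: (ideal_add hP).
  apply: (Pd _ _ (mvsub_tri MV z y x)); exact: (ideal_add hP).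
- have half x x' y y' : P (x ⊖ x') -> P (y ⊖ y') -> P ((x + y) ⊖ (x' + y')).
    move=> h k; apply: (Pd _ _ (mvsub_tri MV _ (x' + y) _)); apply: (ideal_add hP).
      by apply: (Pd _ _ _ h); exact: mvsub_add2r.
    by apply: (Pd _ _ _ k); rewrite !(mvaddC MV x'); exact: mvsub_add2r.
  by move=> x x' y y' [h1 h2] [h3 h4]; split; exact: half.
- by move=> x x' [h1 h2]; split; rewrite mvsubNN.
have g0 a : g a = 0 <-> P a.
  rewrite -(hom0 hg) gE /E mvsubm0 //; split=> [[]//|Pa]; split=> //.
  by apply: (Pd _ _ _ Pa); apply: (mvle_trans MV (mvsub_le MV _ _)); exact: mvle0m.
have HC : is_MVP C := MVP_surj hg sg HA.
have chC : is_chain C.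
  split => //.
    move=> x y; have [a <-] := sg x; have [b <-] := sg y.
    have [h|h] := prime _ _ (mvprelinear MV a b); [left|right];
      by apply/(mvsub0P (MVP_MV HC)); rewrite -hom_sub //; apply/g0.
  move=> e; apply: (FP a0) => //; apply/g0; apply: mvle_m0; first exact: MVP_MV HC.
  by rewrite e; exact: (mvlem1 (MVP_MV HC)).
have [G [f [[hf f1 f2] fi]]] := chain_rep chC.
exists G, (f \o g); split.
- split; first exact: comp_hom.
    by move=> a; exact: f1.
  move=> y /f2[c <-]; have [a <-] := sg c; by exists a.
- by move=> a Ia /=; rewrite (iffRL (g0 a)) ?(hom0 hf) //; exact: IP.
- by move=> a Fa /= /fi /g0; exact: FP.
Qed.

Lemma zero_ideal (A : mvstr) : is_MV A -> is_ideal [set (0 : A)].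
Proof.
move=> MV; split; first by exists 0.
  by move=> x y /(mvleE MV) h /= y0; apply: mvle_m0; rewrite // -y0.
by move=> x y /= -> ->; rewrite mvadd0.
Qed.

Lemma rep_nonzero (A : mvstr) (a : A) : is_MVP A -> a <> 0 ->
  exists (G : osp) (f : A -> chang (@opos G)), is_rep f /\ f a <> 0.
Proof.
move=> HA na; have MV := MVP_MV HA.
have [|||G [f [h1 _ h2]]] := @rep_separation A _ [set a] HA (zero_ideal MV).
- by exists a.
- by move=> x y /= -> ->; rewrite mvmeet_eqr //; exact: mvle_refl.
- by move=> x /= ->.
- by exists G, f; split => //; exact: h2.
Qed.

Lemma rep_eq (A : mvstr) (a b : A) : is_MVP A ->
  (forall (G : osp) (f : A -> chang (@opos G)), is_rep f -> f a = f b) -> a = b.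
Proof.
move=> HA h; have MV := MVP_MV HA; apply: contrapT => ab.
have [G [f [rf]]] := rep_nonzero HA (fun k => ab (iffLR (mvdistP MV a b) k)).
have ff := h _ _ rf; rewrite (hom_dist (rep_hom rf)) ff -(hom_dist (rep_hom rf)).
by rewrite (iffRL (mvdistP MV b b)) // (hom0 (rep_hom rf)).
Qed.

Lemma chang_add00 (G : zmodType) (P : pred G) : 0 + 0 = 0 :> chang P.
Proof. by rewrite /= /chang_add /= addr0. Qed.

Section ChangOsp.
Local Open Scope ring_scope.
Variable G : osp.
Let P : pred G := @opos G.
Implicit Types x y : G.
Notation chG := (chang P).

Lemma chang_join_ff x y : P y -> P (x - y) ->
  mvjoin ((false, x) : chG) (false, y) = (false, x).
Proof. by move=> hy h; rewrite /mvjoin /= /chang_add /= h /= subrK. Qed.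
Lemma chang_join_ft x y : P y -> mvjoin ((false, x) : chG) (true, y) = (true, y).
Proof. by move=> h; rewrite /mvjoin /= /chang_add /= subr0 h. Qed.
Lemma chang_join_tf x y : P x -> mvjoin ((true, x) : chG) (false, y) = (true, x).
Proof. by move=> h; rewrite /mvjoin /= /chang_add /= addrK h. Qed.

Lemma chang_meet_tf x y : P y -> mvmeet ((true, x) : chG) (false, y) = (false, y).
Proof.
by move=> h; rewrite -[RHS]/(mvneg ((true, y) : chG)) -(chang_join_ft x h).
Qed.
Lemma chang_meet_ft x y : P x -> mvmeet ((false, x) : chG) (true, y) = (false, x).
Proof.
by move=> h; rewrite -[RHS]/(mvneg ((true, x) : chG)) -(chang_join_tf y h).
Qed.

Lemma chang_muln_f k x : mvmuln k ((false, x) : chG) = (false, x *+ k).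
Proof.
case: k => [//|k]; rewrite /mvmuln iteropS; elim: k => //= k ->.
by rewrite /chang_add /= -mulrS.
Qed.
Lemma chang_muln_t k x : mvmuln k.+2 ((true, x) : chG) = (true, 0).
Proof.
rewrite /mvmuln iteropS; elim: k => [|k IH]; first by rewrite /= /chang_add.
by rewrite iterS IH.
Qed.
Lemma chang_exp_t k x : (0 < k)%N -> mvexp ((true, x) : chG) k = (true, x *+ k).
Proof.
case: k => [//|k] _; rewrite /mvexp iteropS; elim: k => //= k ->.
by rewrite /mvmul /= /chang_add /= -mulrS.
Qed.
Lemma chang_exp_f k x : mvexp ((false, x) : chG) k.+2 = (false, 0).
Proof.
rewrite /mvexp iteropS; elim: k => [|k IH]; first by rewrite /= /chang_add.
by rewrite iterS IH.
Qed.

Lemma chang_t k b x : (0 < k)%N -> P x -> t_ k ((b, x) : chG) = (b, x *+ k).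
Proof.
move=> k0 hx; have hk n : P (x *+ n) by exact: opos_muln.
have P0 : P 0 by exact: opos0.
rewrite /t_; case: b.
  rewrite !chang_exp_t // (chang_muln_t 0).
  have -> : mvmeet (mvmuln k ((true, x) : chG)) (mvneg ((true, 0) : chG)) = (false, 0).
    by case: k k0 => [//|[|k]] _; rewrite ?chang_muln_t chang_meet_tf.
  by rewrite chang_join_ft.
rewrite chang_muln_f (chang_exp_f 0) chang_muln_f mul0rn.
have -> : mvmeet ((false, x *+ k) : chG) (mvneg ((false, 0) : chG)) = (false, x *+ k).
  by rewrite chang_meet_ft.
case: k k0 => [//|[|k]] _.
  by rewrite chang_join_ff // subrr.
by rewrite chang_exp_f chang_join_ff // subr0.
Qed.

Lemma chang_add_eq0 (a b : chG) : P a.2 -> P b.2 -> (a + b)%MV = 0%MV ->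
  a = 0%MV /\ b = 0%MV.
Proof.
case: a b => [[] x] [[] y] //= hx hy [] e.
have x0 := oposD_eq0 hx hy e; move: e; rewrite x0 add0r => ->.
by split.
Qed.

Lemma chang_dist_eq0 (a b : chG) : P a.2 -> P b.2 -> mvdist a b = 0%MV -> a = b.
Proof.
have m u : P u || P (- u) by exact: opos_total.
case: a b => [[] x] [[] y] //= hx hy; rewrite /mvdist /monus /= /chang_add /=.
- case: ifP => h; case: ifP => k; rewrite ?addr0 ?add0r => /(congr1 snd) /= e.
  + by congr (_, _); apply: oposB_anti.
  + by congr (_, _); apply/eqP; rewrite eq_sym -subr_eq0 e.
  + by congr (_, _); apply/eqP; rewrite -subr_eq0 e.
  + by have := m (x - y); rewrite opprB h k.
- case: ifP => h; case: ifP => k; rewrite ?addr0 ?add0r => /(congr1 snd) /= e.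
  + by congr (_, _); apply: oposB_anti.
  + by congr (_, _); apply/eqP; rewrite -subr_eq0 e.
  + by congr (_, _); apply/eqP; rewrite eq_sym -subr_eq0 e.
  + by have := m (x - y); rewrite opprB h k.
Qed.

Lemma chang_meet_eq0 (a b : chG) : P a.2 -> P b.2 -> mvmeet a b = 0%MV ->
  a = 0%MV \/ b = 0%MV.
Proof.
case: a b => [[] x] [[] y] //= hx hy; rewrite /mvmeet /mvjoin /= /chang_add //=.
- by rewrite subr0 hy => -[->]; right.
- by rewrite addrK hx => -[->]; left.
- case: (boolP (P (y - x))) => h.
    by rewrite subKr hx => -[->]; left.
  by rewrite subr0 hy => -[->]; right.
Qed.

Definition chang_scale (k : nat) (a : chG) : chG := (a.1, a.2 *+ k).

Lemma chang_tE k (a : chG) : (0 < k)%N -> P a.2 -> t_ k a = chang_scale k a.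
Proof. by case: a => b x; exact: chang_t. Qed.

Lemma chang_scale_hom k : (0 < k)%N -> is_hom (chang_scale k).
Proof.
move=> k0; split => [[b x] [c y]|x|] //=; last by rewrite /chang_scale /= mul0rn.
rewrite /chang_scale /chang_add; case: b c => [] [] /=;
  rewrite ?mul0rn ?mulrnDl // -mulrnBl /P opos_mulnE //;
  by case: ifP => _; rewrite ?mul0rn.
Qed.
End ChangOsp.

Section Representation.
Variables (A : mvstr) (HA : is_MVP A).
Let MV := MVP_MV HA.

Lemma t_hom k : (0 < k)%N -> is_hom (@t_ A k).
Proof.
move=> k0.
have tE (G : osp) (f : A -> chang (@opos G)) : is_rep f ->
  forall x, f (t_ k x) = chang_scale k (f x).
  by move=> rf x; rewrite (hom_t (rep_hom rf)) chang_tE //; exact: rep_pos.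
split=> [x y|x|]; apply: rep_eq => // G f rf; have hf := rep_hom rf;
  have hs := chang_scale_hom G k0; rewrite ?(tE _ _ rf).
- by rewrite (homD hf x y) (homD hs) (homD hf (t_ k x)) ?(tE _ _ rf).
- by rewrite (homN hf x) (homN hs) (homN hf (t_ k x)) ?(tE _ _ rf).
- by rewrite !(hom0 hf) (hom0 hs).
Qed.

Lemma t_inj k : (0 < k)%N -> injective (@t_ A k).
Proof.
move=> k0 x y e; apply: rep_eq => // G f rf; have hf := rep_hom rf.
move: (congr1 f e); rewrite !(hom_t hf) !chang_tE ?(rep_pos rf) //.
by case: (f x) (f y) => [b u] [c v] [-> /(mulrn_oinj k0) ->].
Qed.

Variables (G : osp) (f : A -> chang (@opos G)) (rf : is_rep f).
Let hf := rep_hom rf.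

Lemma rep_add_eq0 a b : f (a + b) = 0 -> f a = 0 /\ f b = 0.
Proof. by rewrite (homD hf); apply: chang_add_eq0; exact: rep_pos. Qed.
Lemma rep_distP a b : f (mvdist a b) = 0 <-> f a = f b.
Proof.
split=> [|e]; first by rewrite (hom_dist hf); apply: chang_dist_eq0; exact: rep_pos.
by rewrite (hom_dist hf) e -(hom_dist hf) (iffRL (mvdistP MV b b)) ?(hom0 hf).
Qed.
Lemma rep_le0 a b : a ⊑ b -> f b = 0 -> f a = 0.
Proof. by move=> /(mvsubK_le MV) <- /rep_add_eq0[]. Qed.
Lemma rep_muln0 k a : f a = 0 -> f (mvmuln k a) = 0.
Proof. by move=> h; rewrite (hom_muln hf) h chang_muln_f mul0rn. Qed.
End Representation.

Lemma mvglue (A : mvstr) (MV : is_MV A) (a b p q : A) :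
  mvdist a b ⊑ p + q ->
  exists c, mvdist c a ⊑ p + p /\ mvdist c b ⊑ q + q.
Proof.
move=> h.
have h1 : a ⊑ b + (p + q).
  by rewrite -(mvsub_leE MV); exact (mvle_trans MV (mvle_addr MV _ _) h).
have h2 : b ⊑ a + (p + q).
  by rewrite -(mvsub_leE MV); exact (mvle_trans MV (mvle_addl MV _ _) h).
exists (mvmeet (mvjoin b (a ⊖ p)) (a + p)).
set c := mvmeet _ _; split; apply: mvle_add => //; rewrite mvsub_leE //.
- exact: mvle_meetr.
- rewrite (mvaddC MV) -(mvsub_leE MV); apply: mvmeet_glb => //.
    exact: mvle_joinr.
  exact (mvle_trans MV (mvsub_le MV _ _) (mvle_addr MV _ _)).
- apply: (mvle_trans MV (mvle_meetl MV _ _)); apply: mvjoin_lub => //.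
    exact: mvle_addr.
  by rewrite mvsub_leE // (mvaddCA MV).
- rewrite (mvaddC MV) -(mvsub_leE MV); apply: mvmeet_glb => //.
    exact (mvle_trans MV (mvsub_le MV _ _) (mvle_joinl MV _ _)).
  by rewrite mvsub_leE // (mvaddC MV q) -(mvaddA MV).
Qed.

Lemma hom_sum_env (B C : mvstr) (g : B -> C) (hg : is_hom g) (X Z : Type)
  (x : X -> B) (z : Z -> B) u :
  eval (sum_env (g \o x) (g \o z)) u = g (eval (sum_env x z) u).
Proof. by rewrite hom_eval //; apply: eval_ext => -[]. Qed.

(** * EFD-sentences are tested on chain quotients *)

Section LocalGlobal.
Variables (A : mvstr) (HA : is_MVP A).
Let MV := MVP_MV HA.
Variables (n m k : nat) (s t : 'I_k.+1 -> term ('I_n + 'I_m.+1)).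

Definition efd_sol (B : mvstr) (x : 'I_n -> B) (z : 'I_m.+1 -> B) : Prop :=
  forall i, eval (sum_env x z) (s i) = eval (sum_env x z) (t i).

Lemma efd_sol_hom (B C : mvstr) (g : B -> C) x z : is_hom g ->
  efd_sol x z -> efd_sol (g \o x) (g \o z).
Proof. by move=> hg h i; rewrite !hom_sum_env // h. Qed.
Lemma efd_sol_inj (B C : mvstr) (g : B -> C) x z : is_hom g -> injective g ->
  efd_sol (g \o x) (g \o z) -> efd_sol x z.
Proof. by move=> hg gi h i; apply: gi; rewrite -!hom_sum_env. Qed.

Definition efd_defect (x : 'I_n -> A) (z : 'I_m.+1 -> A) : A :=
  foldr mvadd 0 [seq mvdist (eval (sum_env x z) (s i)) (eval (sum_env x z) (t i))
                | i <- enum 'I_k.+1].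

Lemma efd_defectP (G : osp) (f : A -> chang (@opos G)) x z : is_rep f ->
  f (efd_defect x z) = 0 <-> efd_sol (f \o x) (f \o z).
Proof.
move=> rf; have hf := rep_hom rf; rewrite /efd_defect; split=> [h i|h].
  rewrite !hom_sum_env //; apply/(rep_distP HA rf).
  have : i \in enum 'I_k.+1 by rewrite mem_enum.
  elim: (enum _) h => //= j r IH /(rep_add_eq0 rf)[h1 h2].
  by rewrite inE => /orP[/eqP ->|/IH]; [|exact].
elim: (enum _) => [|j r IH] /=; first exact: (hom0 hf).
have e : f (mvdist (eval (sum_env x z) (s j)) (eval (sum_env x z) (t j))) = 0.
  by apply/(rep_distP HA rf); rewrite -!hom_sum_env.
by rewrite (homD hf) IH e chang_add00.
Qed.

Hypothesis efd_ex : forall (G : osp) (f : A -> chang (@opos G)), is_rep f ->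
  forall x, exists z, efd_sol (f \o x) (f \o z).
Hypothesis efd_uniq : forall (G : osp) (f : A -> chang (@opos G)), is_rep f ->
  forall x z z', efd_sol (f \o x) (f \o z) -> efd_sol (f \o x) (f \o z') ->
  forall j, f (z j) = f (z' j).

Lemma efd_glue x z z' : exists w, forall (G : osp) (f : A -> chang (@opos G)),
  is_rep f -> efd_sol (f \o x) (f \o z) \/ efd_sol (f \o x) (f \o z') ->
  efd_sol (f \o x) (f \o w).
Proof.
set u := efd_defect x z; set u' := efd_defect x z'.
have bound j : exists l, mvdist (z j) (z' j) ⊑ mvmuln l (u + u').
  apply: contrapT => no.
  have [||||G [f [rf f0 f1]]] := @rep_separation A
    [set a | exists l, a ⊑ mvmuln l (u + u')] [set mvdist (z j) (z' j)] HA.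
  - split.
    + by exists 0, 0%N; exact: mvle_refl.
    + move=> a b /(mvleE MV) ab [l h]; exists l; exact (mvle_trans MV ab h).
    + move=> a b [l h] [l' h']; exists (l + l')%N.
      by rewrite (mvmulnD MV); exact: mvle_add.
  - by exists (mvdist (z j) (z' j)).
  - by move=> a b /= -> ->; rewrite mvmeet_eqr //; exact: mvle_refl.
  - by move=> a /= -> [l h]; apply: no; exists l.
  have e0 : f (u + u') = 0 by apply: f0; exists 1%N; exact: mvle_refl.
  apply: (f1 _ erefl); apply/(rep_distP HA rf).
  by have [/(efd_defectP _ _ rf) h /(efd_defectP _ _ rf) h'] := rep_add_eq0 rf e0;
    exact: (efd_uniq rf h h').
have /choice[w hw] j : exists c l, mvdist c (z j) ⊑ mvmuln l u + mvmuln l u /\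
    mvdist c (z' j) ⊑ mvmuln l u' + mvmuln l u'.
  have [l] := bound j; rewrite (mvmuln_addm MV) => /(mvglue MV)[c hc].
  by exists c, l.
exists w => G f rf [] /(efd_defectP _ _ rf) h; have hf := rep_hom rf.
  have e j : f (w j) = f (z j).
    have [l [h1 _]] := hw j; apply/(rep_distP HA rf); apply: (rep_le0 HA rf h1).
    by rewrite (homD hf) (rep_muln0 rf _ h) chang_add00.
  have -> : f \o w = f \o z by apply/funext => j; exact: e.
  exact/efd_defectP.
have e j : f (w j) = f (z' j).
  have [l [_ h1]] := hw j; apply/(rep_distP HA rf); apply: (rep_le0 HA rf h1).
  by rewrite (homD hf) (rep_muln0 rf _ h) chang_add00.
have -> : f \o w = f \o z' by apply/funext => j; exact: e.
exact/efd_defectP.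
Qed.

(* The solution sets of the single tuples [z] cover the prime spectrum, finitely
   many of them suffice, and local solutions are then glued pairwise. *)
Lemma efd_local_global : satisfies A (Efd s t).
Proof.
move=> x.
pose F : set A := [set a | exists zs, a = foldr mvmeet mvone (map (efd_defect x) zs)].
have Fm a b : F a -> F b -> F (mvmeet a b).
  move=> [zs ->] [zs' ->]; exists (zs ++ zs'); rewrite map_cat foldr_cat.
  elim: zs => [|z zs IH] /=; last by rewrite -mvmeetA // IH.
  by rewrite mvmeet_eqr //; exact: mvlem1.
have [zs hzs] : F 0.
  apply: contrapT => nF0.
  have [|||G [f [rf _ fF]]] := @rep_separation A _ F HA (zero_ideal MV).
  - by exists mvone, [::].
  - exact: Fm.
  - by move=> a Fa /= a0; apply: nF0; rewrite -a0.
  have [z /(efd_defectP _ _ rf)] := efd_ex rf x; apply: fF.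
  by exists [:: z]; rewrite /= mvmeetC // mvmeet_eqr //; exact: mvlem1.
have [z hz] : exists z, forall (G : osp) (f : A -> chang (@opos G)), is_rep f ->
    f (foldr mvmeet mvone (map (efd_defect x) zs)) = 0 -> efd_sol (f \o x) (f \o z).
  elim: zs {hzs} => [|z zs [z' IH]].
    exists (fun=> 0) => G f rf /=; rewrite (hom1 (rep_hom rf)).
    by [].
  have [w hw] := efd_glue x z z'; exists w => G f rf /= h; apply: hw => //.
  move: h; rewrite (hom_meet (rep_hom rf)) => h.
  have [e|e] := chang_meet_eq0 (rep_pos rf _) (rep_pos rf _) h.
  - by left; apply/efd_defectP.
  - by right; apply: IH.
have sz : efd_sol x z.
  move=> i; apply: rep_eq => // G f rf; rewrite -!(hom_sum_env (rep_hom rf)).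
  by apply: hz => //; rewrite -hzs; exact: hom0 (rep_hom rf).
exists z; split => // z' sz'; apply/funext => j; apply: rep_eq => // G f rf.
by apply: (efd_uniq rf (x := x)); apply: efd_sol_hom => //; exact: rep_hom.
Qed.
End LocalGlobal.

(** * Linear forms and transfer between ordered groups *)

Local Open Scope ring_scope.

Section LinearForms.
Variable G : zmodType.
Implicit Types (u : nat -> G) (f g : {poly int}).

(* An integer polynomial encodes the linear form whose coefficient at the i-th
   variable is its coefficient at ['X^i]. *)
Definition form_eval u f : G := \sum_(i < size f) u i *~ f`_i.

Lemma form_eval_widen u f k : (size f <= k)%N ->
  form_eval u f = \sum_(i < k) u i *~ f`_i.
Proof.
move=> h; rewrite /form_eval (big_ord_widen k (fun i => u i *~ f`_i)) //.
rewrite [RHS](bigID (fun i : 'I_k => (i < size f)%N)) /= [X in _ + X]big1 ?addr0 //.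
by move=> i; rewrite -leqNgt => /(nth_default 0) ->; rewrite mulr0z.
Qed.
Lemma form_evalD u f g : form_eval u (f + g) = form_eval u f + form_eval u g.
Proof.
have h := size_polyD f g.
rewrite (form_eval_widen u h) (form_eval_widen u (leq_maxl _ (size g))).
rewrite (form_eval_widen u (leq_maxr (size f) _)) -big_split /=.
by apply: eq_bigr => i _; rewrite coefD mulrzDr.
Qed.
Lemma form_eval0 u : form_eval u 0 = 0.
Proof. by rewrite /form_eval size_poly0 big_ord0. Qed.
Lemma form_evalN u f : form_eval u (- f) = - form_eval u f.
Proof. by apply/eqP; rewrite -addr_eq0 -form_evalD addNr form_eval0. Qed.
Lemma form_evalB u f g : form_eval u (f - g) = form_eval u f - form_eval u g.
Proof. by rewrite form_evalD form_evalN. Qed.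
Lemma form_evalMn u f n : form_eval u (f *+ n) = form_eval u f *+ n.
Proof. by elim: n => [|n IH]; rewrite ?form_eval0 // !mulrS form_evalD IH. Qed.
Lemma form_evalX u i : form_eval u 'X^i = u i.
Proof.
rewrite /form_eval size_polyXn big_ord_recr /= coefXn eqxx mulr1z.
by rewrite big1 ?add0r // => j _; rewrite coefXn ltn_eqF // mulr0z.
Qed.
Lemma eq_form_eval k u u' f : (size f <= k)%N -> (forall i, (i < k)%N -> u i = u' i) ->
  form_eval u f = form_eval u' f.
Proof.
by move=> h e; rewrite !(form_eval_widen _ h); apply: eq_bigr => i _; rewrite e.
Qed.
End LinearForms.

Section SymbolicEval.
Variables (V : Type) (e : V -> {poly int}).

Fixpoint form_values (t : term V) : seq {poly int} :=
  match t with
  | TVar v => [:: e v]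
  | TAdd a b => 0 :: [seq f + g | f <- form_values a, g <- form_values b] ++
      ([seq f - g | f <- form_values a, g <- form_values b] ++
       [seq g - f | f <- form_values a, g <- form_values b])
  | TNeg a => form_values a
  | TZero => [:: 0]
  end.

(* The linear forms whose signs decide every comparison made while evaluating
   a term in a perfect chain. *)
Fixpoint form_tests (t : term V) : seq {poly int} :=
  match t with
  | TAdd a b => form_tests a ++ (form_tests b ++
      ([seq f - g | f <- form_values a, g <- form_values b] ++
       [seq g - f | f <- form_values a, g <- form_values b]))
  | TNeg a => form_tests a
  | _ => [::]
  end.

Variable beta : V -> bool.
Definition sym_eval (o : pred {poly int}) (t : term V) : bool * {poly int} :=
  @eval (chang o) V (fun v => (beta v, e v)) t.

Lemma sym_eval_values o t : (sym_eval o t).2 \in form_values t.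
Proof.
elim: t => [v|a IHa b IHb|a IHa|]; rewrite ?inE //= /sym_eval /= ?inE //.
move: IHa IHb; rewrite /sym_eval /chang_add.
case: (eval _ a) => [c f] /=; case: (eval _ b) => [d g] /= hf hg.
rewrite !mem_cat; case: c d => [] [] /=; first by rewrite eqxx.
- by case: ifP => _; rewrite ?eqxx // (allpairs_f (fun f g => f - g)) ?orbT.
- by case: ifP => _; rewrite ?eqxx // (allpairs_f (fun f g => g - f)) ?orbT.
- by rewrite (allpairs_f (fun f g => f + g)) ?orbT.
Qed.

Lemma sym_eval_agree o o' t : {in form_tests t, o =1 o'} ->
  sym_eval o t = sym_eval o' t.
Proof.
elim: t => [v|a IHa b IHb|a IHa|] //= h; last first.
  by rewrite /sym_eval /= -!/(sym_eval _ _) IHa.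
have ha : {in form_tests a, o =1 o'} by move=> f hf; apply: h; rewrite mem_cat hf.
have hb : {in form_tests b, o =1 o'} by move=> f hf; apply: h; rewrite !mem_cat hf orbT.
rewrite /sym_eval /= -!/(sym_eval _ _) -IHa // -IHb //.
have := sym_eval_values o a; have := sym_eval_values o b.
case: (sym_eval o a) => [c f]; case: (sym_eval o b) => [d g] /= hg hf.
rewrite /chang_add; case: c d => [] [] //=; rewrite h // !mem_cat.
  by rewrite (allpairs_f (fun f g => f - g)) ?orbT.
by rewrite (allpairs_f (fun f g => g - f)) ?orbT.
Qed.
End SymbolicEval.

Definition form_agree (L : seq {poly int}) (G H : osp) (u : nat -> G) (v : nat -> H) :=
  {in L, forall f, opos (form_eval u f) = opos (form_eval v f)}.

Section Transfer.
Variables (V : Type) (idx : V -> nat) (beta : V -> bool).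
Let e (v : V) : {poly int} := 'X^(idx v).

Definition chang_env (G : zmodType) (u : nat -> G) (v : V) : bool * G :=
  (beta v, u (idx v)).

Definition chang_eval (G : osp) (u : nat -> G) (t : term V) : bool * G :=
  @eval (chang (@opos G)) V (chang_env u) t.

Lemma eval_symbolic (G : osp) (u : nat -> G) t : chang_eval u t =
  let r := sym_eval e beta (fun f => opos (form_eval u f)) t in
  (r.1, form_eval u r.2).
Proof.
pose h (a : chang (fun f : {poly int} => opos (form_eval u f))) : chang (@opos G) :=
  (a.1, form_eval u a.2).
have hh : is_hom h.
  split=> [[b f] [c g]|a|]; rewrite /h //= ?form_eval0 // /chang_add.
  case: b c => [] [] /=; rewrite ?form_eval0 ?form_evalD // -?form_evalN -?form_evalD //;
    by case: ifP; rewrite ?form_eval0.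
transitivity (h (sym_eval e beta (fun f => opos (form_eval u f)) t)); last by [].
rewrite /chang_eval /sym_eval hom_eval //; apply: (@eval_ext (chang (@opos G))) => v.
by rewrite /h /chang_env /= form_evalX.
Qed.

Definition eq_tests (s t : term V) : seq {poly int} := form_tests e (TAdd s t).

Lemma eval_eq_transfer (G H : osp) (u : nat -> G) (v : nat -> H) s t :
  form_agree (eq_tests s t) u v ->
  chang_eval u s = chang_eval u t -> chang_eval v s = chang_eval v t.
Proof.
move=> h.
set o := fun f : {poly int} => opos (form_eval u f).
set o' := fun f : {poly int} => opos (form_eval v f).
have os : sym_eval e beta o' s = sym_eval e beta o s.
  by apply: sym_eval_agree => f hf; rewrite /o /o' h // /eq_tests /= mem_cat hf.
have ot : sym_eval e beta o' t = sym_eval e beta o t.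
  by apply: sym_eval_agree => f hf; rewrite /o /o' h // /eq_tests /= !mem_cat hf orbT.
rewrite !eval_symbolic /= -/o -/o' os ot => -[e1 e2]; congr (_, _) => //.
set f := (sym_eval e beta o s).2 in e2 *; set g := (sym_eval e beta o t).2 in e2 *.
have hf : f \in form_values e s by exact: sym_eval_values.
have hg : g \in form_values e t by exact: sym_eval_values.
have p0 : opos (0 : G) by exact: opos0.
apply: oposB_anti; rewrite -form_evalB -h ?form_evalB ?e2 ?subrr //
  /eq_tests /= !mem_cat.
  by rewrite (allpairs_f (fun f g => f - g)) ?orbT.
by rewrite (allpairs_f (fun f g => g - f)) ?orbT.
Qed.
End Transfer.

Section Extension.

Lemma spos_opos (K : osp) (x : K) : ~~ opos (- x) -> opos x.
Proof. by move/oposN; rewrite opprK. Qed.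
Lemma sposD (K : osp) (x y : K) : ~~ opos (- x) -> opos y -> ~~ opos (- (y + x)).
Proof.
move=> hx hy; apply: contra hx => h.
by have := oposD h hy; rewrite opprD addrAC addNr add0r.
Qed.

Lemma osp_max (K : osp) (T : eqType) (x : T -> K) (s : seq T) : s != [::] ->
  exists2 i, i \in s & forall j, j \in s -> opos (x i - x j).
Proof.
elim: s => //= i [|j s] IH _.
  by exists i => [|j]; rewrite inE // => /eqP ->; rewrite subrr opos0.
have [//|m ms mm] := IH; have := opos_total (x i - x m); rewrite opprB.
move=> /orP[h|h]; last first.
  by exists m => [|l]; rewrite inE ?ms ?orbT // => /predU1P[->|/mm].
exists i => [|l]; rewrite inE ?eqxx // => /predU1P[->|ls]; first by rewrite subrr opos0.
by have := oposD h (mm l ls); rewrite addrA subrK.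
Qed.

Definition osp_divisible (H : osp) :=
  forall (d : nat) (x : H), (0 < d)%N -> exists y, y *+ d = x.

Lemma osp_between (H : osp) (T : eqType) (y : T -> H) (lo up : seq T) (e : H) :
  osp_divisible H -> ~~ opos (- e) ->
  (forall i j, i \in lo -> j \in up -> ~~ opos (y i - y j)) ->
  exists b, (forall i, i \in lo -> ~~ opos (y i - b)) /\
            (forall j, j \in up -> ~~ opos (b - y j)).
Proof.
move=> Hdiv he hlu.
have [lo0|lo0] := eqVneq lo [::]; have [up0|up0] := eqVneq up [::].
- by exists 0; rewrite lo0 up0.
- have [m mu hm] := osp_max (fun i => - y i) up0.
  exists (y m - e); rewrite lo0; split=> // j /hm; rewrite opprK addrC => h.
  have := sposD he h; congr (~~ opos _).
  by rewrite !opprD opprK [RHS]addrAC [- y j + _]addrC.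
- have [m mu hm] := osp_max y lo0.
  exists (y m + e); rewrite up0; split=> // i /hm h.
  by have := sposD he h; rewrite addrAC opprB.
have [M Ml hM] := osp_max y lo0; have [m mu hm] := osp_max (fun i => - y i) up0.
have [h hh] := Hdiv 2%N (y m - y M) isT.
have sh : ~~ opos (- h).
  by have := hlu _ _ Ml mu; rewrite -(opos_mulnE (- h) (n := 2)) // mulNrn hh opprB.
exists (y M + h); split=> [i /hM k|j /hm k].
  by have := sposD sh k; rewrite addrAC opprB.
have := sposD sh k; congr (~~ opos _).
have -> : y M + h = y m - h.
  by apply/eqP; rewrite eq_sym subr_eq -addrA -mulr2n hh addrC subrK.
by rewrite !opprD !opprK [RHS]addrAC.
Qed.

Lemma osp_extend (G H : osp) (T : eqType) (x : T -> G) (y : T -> H) (s : seq T) (e : H) :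
  osp_divisible H -> ~~ opos (- e) ->
  (forall i j, i \in s -> j \in s -> opos (x i - x j) = opos (y i - y j)) ->
  forall a, exists b, forall i, i \in s ->
    opos (a - x i) = opos (b - y i) /\ opos (x i - a) = opos (y i - b).
Proof.
move=> Hdiv he hxy a.
have [[i [is_ xi]]|no] := pselect (exists i, i \in s /\ x i = a).
  by exists (y i) => j js; rewrite -xi !hxy.
have nx i : i \in s -> x i <> a by move=> is_ xi; apply: no; exists i.
pose lo := [seq i <- s | opos (a - x i)]; pose up := [seq i <- s | opos (x i - a)].
have [|b [hl hu]] := @osp_between H T y lo up e Hdiv he.
  move=> i j; rewrite !mem_filter => /andP[hi is_] /andP[hj js].
  rewrite -hxy //; apply/negP => h.
  by apply: (nx i) => //; apply: oposB_anti => //; have := oposD h hj; rewrite addrA subrK.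
have eqs i : i \in s -> opos (a - x i) -> opos (x i - a) = false.
  by move=> is_ h; apply/negP => h'; apply: (nx i) => //; exact: oposB_anti.
have eqs' i : i \in s -> opos (x i - a) -> opos (a - x i) = false.
  by move=> is_ h; apply/negP => h'; apply: (nx i) => //; exact: oposB_anti.
exists b => i is_; have := opos_total (a - x i); rewrite opprB => /orP[h|h].
  have k := hl i; rewrite mem_filter h is_ in k; have {}k := k isT.
  have k' : opos (b - y i) by apply: spos_opos; rewrite opprB.
  by rewrite (eqs _ is_ h) h k' (negbTE k).
have k := hu i; rewrite mem_filter h is_ in k; have {}k := k isT.
have k' : opos (y i - b) by apply: spos_opos; rewrite opprB.
by rewrite (eqs' _ is_ h) h k' (negbTE k).
Qed.

(* One round of the back-and-forth between an ordered group and a divisible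
   one; eliminating the variable [k] is a Fourier-Motzkin step. *)
Lemma form_agree_step (k : nat) (L : seq {poly int}) :
  {in L, forall f : {poly int}, (size f <= k.+1)%N} ->
  exists L' : seq {poly int}, {in L', forall f : {poly int}, (size f <= k)%N} /\
    forall (G H : osp) (u : nat -> G) (v : nat -> H) (e : H),
    osp_divisible H -> ~~ opos (- e) -> form_agree L' u v ->
    forall a, exists b, forall u' v',
      (forall i, (i < k)%N -> u' i = u i) -> (forall i, (i < k)%N -> v' i = v i) ->
      u' k = a -> v' k = b -> form_agree L u' v'.
Proof.
move=> Lk.
pose ts := [seq f : {poly int} <- L | f`_k != 0].
pose D := (\prod_(f <- ts) absz (f`_k)%R)%N.
pose q (f : {poly int}) := (D %/ absz (f`_k)%R)%N.
have Dq f : f \in ts -> (D = q f * absz (f`_k)%R)%N.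
  by move=> fs; rewrite /q divnK // /D (big_rem f) //= dvdn_mulr.
have D0 : (0 < D)%N.
  rewrite /D big_seq; apply: prodn_cond_gt0 => f.
  by rewrite mem_filter absz_gt0 => /andP[].
have q0 f : f \in ts -> (0 < q f)%N.
  by move=> /Dq e; move: D0; rewrite e muln_gt0 => /andP[].
pose g (f : {poly int}) := (f *~ sgz (f`_k)) *+ q f - 'X^k *+ D.
have gk f : f \in ts -> (size (g f) <= k)%N.
  move=> fs; have [fk fL] : f`_k != 0 /\ f \in L.
    by move: fs; rewrite mem_filter => /andP[].
  apply/leq_sizeP => j; rewrite leq_eqVlt => /predU1P[<-|kj].
    rewrite coefB !coefMn coefMrz coefXn eqxx (Dq _ fs) mulrzz mulrC -abszEsg.
    by rewrite [(q f * _)%N]mulnC mulrnA natz subrr.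
  rewrite coefB !coefMn coefMrz coefXn gtn_eqF // mul0rn subr0.
  by rewrite nth_default ?mul0rz ?mul0rn // (leq_trans (Lk _ fL)).
exists ([seq f : {poly int} <- L | f`_k == 0] ++ [seq g h - g f | f <- ts, h <- ts]); split.
  move=> f; rewrite mem_cat mem_filter => /orP[/andP[/eqP f0 fL]|].
    apply/leq_sizeP => j; rewrite leq_eqVlt => /predU1P[<- //|kj].
    by rewrite nth_default // (leq_trans (Lk _ fL)).
  move=> /allpairsP[[f1 f2] /= [h1 h2 ->]].
  by rewrite (leq_trans (size_polyD _ _)) // geq_max size_polyN !gk.
move=> G H u v e Hdiv he huv a.
have key (K : osp) (w w' : nat -> K) f : f \in ts ->
    (forall i, (i < k)%N -> w' i = w i) ->
    form_eval w' (f *~ sgz (f`_k)) *+ q f = form_eval w (g f) + w' k *+ D.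
  move=> fs ww; rewrite -form_evalMn -[_ *+ q f](subrK ('X^k *+ D)) form_evalD.
  by rewrite form_evalMn form_evalX -/(g f) (eq_form_eval (gk _ fs) ww).
have [|b' hb'] := @osp_extend G H _ (fun f => - form_eval u (g f))
    (fun f => - form_eval v (g f)) ts e Hdiv he _ (a *+ D).
  move=> i j hi hj; rewrite !opprK ![- _ + _]addrC -!form_evalB huv //.
  by rewrite mem_cat (allpairs_f (fun f h => g h - g f)) ?orbT.
have [b hb] := Hdiv D b' D0.
exists b => u' v' uu vv ua vb f fL; have [f0|f0] := eqVneq f`_k 0.
  have fk : (size f <= k)%N.
    apply/leq_sizeP => j; rewrite leq_eqVlt => /predU1P[<- //|kj].
    by rewrite nth_default // (leq_trans (Lk _ fL)).
  rewrite (eq_form_eval fk uu) (eq_form_eval fk vv) huv //.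
  by rewrite mem_cat mem_filter f0 eqxx fL.
have fs : f \in ts by rewrite mem_filter f0.
have [h1 h2] := hb' f fs; rewrite !opprK in h1.
have ku := key _ u u' f fs uu; have kv := key _ v v' f fs vv.
rewrite ua addrC in ku; rewrite vb hb addrC in kv.
move: ku kv h1 h2; case: sgzP f0 => // c _; rewrite ?mulr1z ?mulrN1z => ku kv h1 h2.
  by rewrite -(opos_mulnE _ (q0 _ fs)) -[in RHS](opos_mulnE _ (q0 _ fs)) ku kv.
rewrite -[in LHS](opos_mulnE _ (q0 _ fs)) -[in RHS](opos_mulnE _ (q0 _ fs)).
have neg (K : osp) (w : nat -> K) : form_eval w f *+ q f = - (form_eval w (- f) *+ q f).
  by rewrite form_evalN mulNrn opprK.
by rewrite (neg _ u') (neg _ v') ku kv !opprD [- (a *+ D) + _]addrC [- b' + _]addrC.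
Qed.

Lemma form_agree_steps (k m : nat) (L : seq {poly int}) :
  {in L, forall f : {poly int}, (size f <= k + m)%N} ->
  exists L' : seq {poly int}, {in L', forall f : {poly int}, (size f <= k)%N} /\
    forall (G H : osp) (u : nat -> G) (v : nat -> H) (e : H),
    osp_divisible H -> ~~ opos (- e) -> form_agree L' u v ->
    exists v', (forall i, (i < k)%N -> v' i = v i) /\ form_agree L u v'.
Proof.
elim: m L => [|m IH] L Lk.
  exists L; split; first by move=> f /Lk; rewrite addn0.
  by move=> G H u v e _ _ h; exists v.
have [|L1 [hL1 k1]] := @form_agree_step (k + m) L; first by move=> f /Lk; rewrite addnS.
have [L2 [hL2 k2]] := IH L1 hL1; exists L2; split=> // G H u v e Hd he h2.
have [v1 [vv1 h1]] := k2 _ _ _ _ _ Hd he h2.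
have [b hb] := k1 _ _ _ _ _ Hd he h1 (u (k + m)%N).
exists (fun i => if i == (k + m)%N then b else v1 i); split.
  by move=> i ik; rewrite ltn_eqF ?vv1 // (leq_trans ik) ?leq_addr.
apply: hb => // [i ik|]; last by rewrite eqxx.
by rewrite ltn_eqF.
Qed.
End Extension.

Definition chang_nat_add (x y : bool * nat) : bool * nat :=
  match x.1, y.1 with
  | false, false => (false, x.2 + y.2)%N
  | false, true => (true, y.2 - x.2)%N
  | true, false => (true, x.2 - y.2)%N
  | true, true => (true, 0%N)
  end.

(* Chang's algebra; truncated subtraction is the right operation here. *)
Definition chang_nat : mvstr :=
  @MVStr (bool * nat) chang_nat_add (fun x => (~~ x.1, x.2)) (false, 0%N).

Section ChangNat.
Variable G : osp.

Definition chang_of_nat (r : G) (x : chang_nat) : chang (@opos G) := (x.1, r *+ x.2).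

Lemma chang_sub_nat (r : G) (a c : nat) : opos r ->
  (if opos (r *+ c - r *+ a) then r *+ c - r *+ a else 0) = r *+ (c - a)%N.
Proof.
move=> hr; have [ac|ca] := leqP a c.
  by rewrite -mulrnBr // opos_muln.
have -> : (c - a)%N = 0%N by apply/eqP; rewrite subn_eq0 ltnW.
rewrite mulr0n; case: ifP => // h; apply: opos_anti => //.
by rewrite opprB -mulrnBr ?opos_muln // ltnW.
Qed.

Lemma chang_of_nat_hom r : opos r -> is_hom (chang_of_nat r).
Proof.
move=> hr; split=> [[b x] [c y]|x|] //; rewrite /chang_of_nat /= /chang_add /chang_nat_add.
by case: b c => [] [] /=; rewrite ?chang_sub_nat ?mulrnDr.
Qed.
Lemma chang_of_nat_inj r : r != 0 -> opos r -> injective (chang_of_nat r).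
Proof.
move=> r0 hr [b x] [c y] [-> e]; congr (_, _).
wlog xy : x y e / (x <= y)%N.
  by move=> h; have [/h|/ltnW/h] := leqP x y => -> //.
move: xy; rewrite leq_eqVlt => /predU1P[//|xy].
have : r *+ (y - x) == 0 by rewrite mulrnBr ?e ?subrr // ltnW.
by rewrite mulrn_oeq0 ?subn_gt0 // (negbTE r0).
Qed.
End ChangNat.

Lemma rat_oposD (x y : rat) : 0 <= x -> 0 <= y -> 0 <= x + y.
Proof. exact: addr_ge0. Qed.
Lemma rat_opos_anti (x : rat) : 0 <= x -> 0 <= - x -> x = 0.
Proof. by rewrite oppr_ge0 => h k; apply/eqP; rewrite eq_le k h. Qed.
Lemma rat_opos_total (x : rat) : (0 <= x) || (0 <= - x).
Proof. by rewrite oppr_ge0 le_total. Qed.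
Definition rat_osp : osp := @Osp rat (fun x => 0 <= x) rat_oposD rat_opos_anti rat_opos_total.

Lemma rat_divisible : osp_divisible rat_osp.
Proof.
move=> d x d0; exists (x / d%:R : rat); rewrite -[LHS]mulr_natr divfK //.
by rewrite pnatr_eq0 -lt0n.
Qed.

Definition natQ (w : nat -> nat) (i : nat) : rat_osp := (w i)%:R : rat.

Lemma form_eval_mul (u : nat -> rat) (c : rat) f :
  form_eval (fun i => c * u i) f = c * form_eval u f.
Proof. by rewrite /form_eval mulr_sumr; apply: eq_bigr => i _; rewrite mulrzAr. Qed.

Lemma common_denominator (u : nat -> rat) K : exists2 N : nat, (0 < N)%N &
  forall i, (i < K)%N -> 0 <= u i -> exists w : nat, N%:R * u i = w%:R.
Proof.
elim: K => [|K [N N0 h]]; first by exists 1%N.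
exists (N * absz (denq (u K)))%N; first by rewrite muln_gt0 N0 absz_gt0 denq_eq0.
have dE : (absz (denq (u K)))%:R = (denq (u K))%:~R :> rat.
  by rewrite -{2}(gez0_abs (denq_ge0 (u K))) -pmulrn.
move=> i; rewrite ltnS leq_eqVlt => /predU1P[-> u0|iK u0].
  exists (N * absz (numq (u K)))%N; rewrite natrM dE -mulrA [_ * u K]mulrC -numqE natrM.
  by congr (_ * _); rewrite -{1}(gez0_abs (m := numq (u K))) ?numq_ge0 // -pmulrn.
have [w hw] := h i iK u0; exists (absz (denq (u K)) * w)%N.
by rewrite natrM mulrAC hw natrM mulrC.
Qed.

Lemma form_agree_nat (G : osp) (u : nat -> G) (L : seq {poly int}) :
  (forall i, opos (u i)) -> exists w : nat -> nat, form_agree L u (natQ w).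
Proof.
move=> hu.
have [K hK] : exists K, {in L, forall f : {poly int}, (size f <= K)%N}.
  elim: L => [|f L [K hK]]; first by exists 0%N.
  exists (maxn (size f) K) => g; rewrite inE => /predU1P[->|/hK h].
    by rewrite leq_max leqnn.
  by rewrite leq_max h orbT.
have [|L' [hL' hA]] := @form_agree_steps 0 K ([seq 'X^i | i <- iota 0 K] ++ L).
  move=> f; rewrite add0n mem_cat => /orP[/mapP[i]|/hK //].
  by rewrite mem_iota add0n => /andP[_ iK] ->; rewrite size_polyXn.
have [|v [_ hv]] := hA G rat_osp u (fun=> 0) 1 rat_divisible isT.
  move=> f /hL'; rewrite leqn0 size_poly_eq0 => /eqP ->.
  by rewrite !form_eval0 !opos0.
have v0 i : (i < K)%N -> 0 <= v i.
  move=> iK; have h := hv 'X^i; rewrite !form_evalX hu in h.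
  by apply: (esym (h _)); rewrite mem_cat map_f // mem_iota.
have [N N0 hN] := common_denominator v K.
have [w hw] : exists w : nat -> nat, forall i, (i < K)%N -> N%:R * v i = (w i)%:R.
  have /choice[w hw] i : exists w : nat, (i < K)%N -> N%:R * v i = w%:R.
    have [iK|] := boolP (i < K)%N; last by exists 0%N.
    by have [w hw] := hN i iK (v0 i iK); exists w.
  by exists w.
exists w => f fL; rewrite hv ?mem_cat ?fL ?orbT //.
rewrite (@eq_form_eval _ K (natQ w) (fun i => N%:R * v i)) ?hK //; last first.
  by move=> i iK; rewrite hw.
by rewrite form_eval_mul /opos /= pmulr_rge0 ?ltr0n.
Qed.

(** * Solutions over the integers *)

Section Infinitesimals.
Variables (A : mvstr) (HA : is_MVP A).

Definition is_rad (r : A) : Prop :=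
  forall (G : osp) (f : A -> chang (@opos G)), is_rep f -> (f r).1 = false.

Definition theta (r : A) (d : chang_nat) : A :=
  if d.1 then mvneg (mvmuln d.2 r) else mvmuln d.2 r.

Lemma rep_theta (G : osp) (f : A -> chang (@opos G)) r d : is_rep f -> is_rad r ->
  f (theta r d) = chang_of_nat (f r).2 d.
Proof.
move=> rf rr; have hf := rep_hom rf; have := rr _ _ rf.
case: d => b l; rewrite /theta /chang_of_nat /=.
case e : (f r) => [c y] /= c0; rewrite c0 in e.
by case: b; rewrite ?(homN hf) (hom_muln hf) e chang_muln_f.
Qed.

Lemma theta_hom r : is_rad r -> is_hom (theta r).
Proof.
move=> rr; split=> [x y|x|//]; apply: rep_eq => // G f rf; have hf := rep_hom rf;
  have hr := rep_pos rf r; have hc := chang_of_nat_hom hr.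
- by rewrite (homD hf) !rep_theta // (homD hc).
- by rewrite (homN hf) !rep_theta // (homN hc).
Qed.

Lemma theta_inj r : is_rad r -> r <> mvzero -> injective (theta r).
Proof.
move=> rr r0 x y e; have [G [f [rf fr0]]] := rep_nonzero HA r0.
have := congr1 f e; rewrite !rep_theta //; apply: chang_of_nat_inj; last exact: rep_pos.
apply/eqP => z; apply: fr0; move: z (rr _ _ rf); case: (f r) => b y' /= -> ->.
by [].
Qed.

Definition radpart (x : A) : A := mvmeet x (mvneg x).

Lemma rep_radpart (G : osp) (f : A -> chang (@opos G)) x : is_rep f ->
  f (radpart x) = (false, (f x).2).
Proof.
move=> rf; have hf := rep_hom rf; rewrite (hom_meet hf) (homN hf).
have := rep_pos rf x; case: (f x) => [[] y] hy.
  exact: (chang_meet_tf y hy).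
exact: (chang_meet_ft y hy).
Qed.
Lemma radpart_rad x : is_rad (radpart x).
Proof. by move=> G f rf; rewrite rep_radpart. Qed.
Lemma radpart_neq0 x : mvadd x x <> x -> radpart x <> mvzero.
Proof.
move=> xx r0; apply: xx; apply: rep_eq => // G f rf; have hf := rep_hom rf.
have := rep_radpart x rf; rewrite r0 (hom0 hf) (homD hf).
by case: (f x) => [[] y] [<-]; rewrite /= /chang_add /= ?addr0.
Qed.
End Infinitesimals.

Lemma epsilonP (A : mvstr) k : satisfies A (epsilon k) <->
  forall x : A, exists! z, t_ k z = x.
Proof.
have E (x : 'I_1 -> A) (z : 'I_1 -> A) :
    eval (sum_env x z) (t_ k (mvvar (inr ord0))) = t_ k (z ord0).
  by rewrite (hom_t (hom_term _)).
split=> [h x|h x].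
  have [z [hz uz]] := h (fun=> x); exists (z ord0); split.
    by have := hz ord0; rewrite E.
  move=> z' hz'; have -> // : z = fun=> z'.
  by apply: uz => i; rewrite E.
have [z [hz uz]] := h (x ord0); exists (fun=> z); split=> [i|z' hz'].
  by rewrite E.
apply/funext => j; rewrite (ord1 j); apply: uz.
by have := hz' ord0; rewrite E.
Qed.

Lemma epsilon_exP (A : mvstr) k : is_MVP A -> (0 < k)%N ->
  satisfies A (epsilon k) <-> forall x : A, exists z, t_ k z = x.
Proof.
move=> HA k0; rewrite epsilonP; split=> h x; have [z] := h x.
  by case=> hz _; exists z.
by move=> hz; exists z; split=> // z' hz'; apply: (t_inj HA k0); rewrite hz hz'.
Qed.

Lemma epsilon_rad (A : mvstr) k : is_MVP A -> (0 < k)%N ->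
  (forall r : A, is_rad r -> exists y, t_ k y = r) -> satisfies A (epsilon k).
Proof.
move=> HA k0 h; apply/epsilon_exP => // x.
have [y hy] := h _ (radpart_rad x).
have [e fe] : exists e, forall (G : osp) (f : A -> chang (@opos G)), is_rep f ->
    f e = mvmuln 2 (mvexp (f x) 2).
  exists (mvmuln 2 (mvexp x 2)) => G f rf.
  by rewrite (hom_muln (rep_hom rf)) (hom_exp (rep_hom rf)).
exists (mvadd (mvmul e (mvneg y)) (mvmul (mvneg e) y)).
apply: rep_eq => // G f rf; have hf := rep_hom rf.
have P0 : opos (0 : G) by exact: opos0.
have := congr1 f hy; rewrite rep_radpart // (hom_t hf) chang_tE ?(rep_pos rf) //.
rewrite (hom_t hf) (homD hf) !(hom_mul hf) !(homN hf) (fe _ _ rf).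
move: (rep_pos rf x) (rep_pos rf y).
case: (f x) (f y) => [b g] [c g'] hg pg' [-> eg]; have hg' : opos g' := pg'.
have m0 : (if opos (- g') then - g' else 0) = 0.
  by case: ifP => // hn; rewrite (opos_anti hg' hn) oppr0.
clear pg'; case: b hg => hg.
  rewrite chang_exp_t // (chang_muln_t 0).
  have -> : mvadd (mvmul ((true, 0) : chang (@opos G)) (mvneg ((false, g') : chang (@opos G))))
      (mvmul (mvneg ((true, 0) : chang (@opos G))) ((false, g') : chang (@opos G))) = (true, g').
    by rewrite /mvmul /= /chang_add /= add0r subr0 hg'.
  by rewrite chang_t // eg.
rewrite (chang_exp_f 0) chang_muln_f mul0rn.
have -> : mvadd (mvmul ((false, 0) : chang (@opos G)) (mvneg ((false, g') : chang (@opos G))))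
    (mvmul (mvneg ((false, 0) : chang (@opos G))) ((false, g') : chang (@opos G))) = (false, g').
  by rewrite /mvmul /= /chang_add /= sub0r subr0 hg' m0 add0r.
by rewrite chang_t // eg.
Qed.

Definition p_int (p : nat) (q : rat) : Prop :=
  exists (N : nat) (c : int), ~~ (p %| N)%N /\ N%:R * q = c%:~R.

Section EfdSolutions.
Variables (n m k : nat) (s t : 'I_k.+1 -> term ('I_n + 'I_m.+1)).

Definition efd_idx (v : 'I_n + 'I_m.+1) : nat :=
  match v with inl i => i | inr j => (n + j)%N end.
Definition efd_x (G : Type) (beta : 'I_n -> bool) (u : nat -> G) (i : 'I_n) := (beta i, u i).
Definition efd_z (G : Type) (gamma : 'I_m.+1 -> bool) (u : nat -> G) (j : 'I_m.+1) :=
  (gamma j, u (n + j)%N).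
Definition efd_tests : seq {poly int} :=
  flatten [seq eq_tests efd_idx (s i) (t i) | i <- enum 'I_k.+1].

Definition chang_sol (G : osp) beta gamma (u : nat -> G) : Prop :=
  @efd_sol n m k s t (chang (@opos G)) (efd_x beta u) (efd_z gamma u).
Definition nat_sol beta gamma (w : nat -> nat) : Prop :=
  @efd_sol n m k s t chang_nat (efd_x beta w) (efd_z gamma w).

Lemma chang_solE (G : osp) beta gamma (u : nat -> G) : chang_sol beta gamma u <->
  forall i, chang_eval efd_idx (sum_env beta gamma) u (s i) =
            chang_eval efd_idx (sum_env beta gamma) u (t i).
Proof.
have E r : @eval (chang (@opos G)) _ (sum_env (efd_x beta u) (efd_z gamma u)) r =
    chang_eval efd_idx (sum_env beta gamma) u r.
  by apply: (@eval_ext (chang (@opos G))) => -[].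
by split=> h i; have := h i; rewrite /= !E.
Qed.

Lemma chang_sol_transfer (G H : osp) beta gamma (u : nat -> G) (v : nat -> H) :
  form_agree efd_tests u v -> chang_sol beta gamma u -> chang_sol beta gamma v.
Proof.
move=> huv /chang_solE h; apply/chang_solE => i; apply: eval_eq_transfer (h i).
move=> f hf; apply: huv; apply/flattenP; exists (eq_tests efd_idx (s i) (t i)) => //.
by apply/map_f; rewrite mem_enum.
Qed.

Lemma nat_solE beta gamma w : nat_sol beta gamma w <-> chang_sol beta gamma (natQ w).
Proof.
have h1 : opos (1 : rat_osp) by [].
have hh := chang_of_nat_hom h1; rewrite /nat_sol /chang_sol.
have -> : efd_x beta (natQ w) = chang_of_nat (1 : rat_osp) \o efd_x beta w by [].
have -> : efd_z gamma (natQ w) = chang_of_nat (1 : rat_osp) \o efd_z gamma w by [].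
split; first exact: efd_sol_hom.
by apply: efd_sol_inj => //; apply: chang_of_nat_inj.
Qed.

Variables (A : mvstr) (HA : is_MVP A) (sat : satisfies A (Efd s t)).
Variables (r : A) (rr : is_rad r) (r0 : r <> mvzero).

Lemma nat_sol_uniq (x : 'I_n -> chang_nat) (z z' : 'I_m.+1 -> chang_nat) :
  efd_sol s t x z -> efd_sol s t x z' -> z = z'.
Proof.
have hr := theta_hom HA rr.
move=> /(efd_sol_hom hr) h /(efd_sol_hom hr) h'.
have [z0 [_ uz]] := sat (theta r \o x).
have e := etrans (esym (uz _ h)) (uz _ h').
apply/funext => j; apply: (theta_inj HA rr r0); exact: (congr1 (fun g => g j) e).
Qed.

Lemma nat_sol_exists beta (v : 'I_n -> nat) : exists N (w : nat -> nat) gamma,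
  [/\ (0 < N)%N, forall i : 'I_n, w i = (N * v i)%N & nat_sol beta gamma w].
Proof.
have hr := theta_hom HA rr.
pose x : 'I_n -> chang_nat := fun i => (beta i, v i).
have [z [hz _]] := sat (theta r \o x).
have [G [f [rf fr0]]] := rep_nonzero HA r0; have hf := rep_hom rf.
set rho := (f r).2; have hrho : opos rho by exact: rep_pos.
have rho0 : rho <> 0.
  move=> e; apply: fr0; move: e (rr rf); rewrite /rho.
  by case: (f r) => b y /= -> ->.
pose M := (n + m.+1)%N.
pose u i : G := if (i < n)%N then rho *+ oapp v 0%N (insub i) else
  if (i < M)%N then (f (z (inord (i - n)))).2 else rho.
have ux (i : 'I_n) : u i = rho *+ v i by rewrite /u ltn_ord valK.
have uz (j : 'I_m.+1) : u (n + j)%N = (f (z j)).2.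
  by rewrite /u ltnNge leq_addr /M ltn_add2l ltn_ord addKn inord_val.
have uM : u M = rho by rewrite /u ltnNge leq_addr ltnn.
have hu i : opos (u i).
  rewrite /u; case: ifP => _; first exact: opos_muln.
  by case: ifP => _ //; exact: rep_pos.
pose L := efd_tests ++ ([seq 'X^(val i) - 'X^M *+ v i | i <- enum 'I_n] ++
  ([seq 'X^M *+ v i - 'X^(val i) | i <- enum 'I_n] ++ [:: - 'X^M])).
have [w hw] := form_agree_nat L hu.
have wM : (0 < w M)%N.
  have := hw (- 'X^M); rewrite !mem_cat inE eqxx !orbT => /(_ isT).
  rewrite !form_evalN !form_evalX uM => h; rewrite lt0n; apply/eqP => w0.
  apply: rho0; apply: opos_anti => //; rewrite h /natQ w0; exact: (opos0 rat_osp).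
exists (w M), w, (fun j => (f (z j)).1); split=> //.
  move=> i.
  have e1 := hw ('X^(val i) - 'X^M *+ v i).
  have e2 := hw ('X^M *+ v i - 'X^(val i)).
  rewrite !form_evalB !form_evalMn !form_evalX uM ux subrr opos0 in e1 e2.
  have {e1} e1 : opos (natQ w i - natQ w M *+ v i).
    rewrite -e1 // !mem_cat; apply/or4P/Or42/mapP; exists i => //; exact: mem_enum.
  have {e2} e2 : opos (natQ w M *+ v i - natQ w i).
    rewrite -e2 // !mem_cat; apply/or4P/Or43/mapP; exists i => //; exact: mem_enum.
  have e := oposB_anti e1 e2; apply/eqP; rewrite -(eqr_nat rat).
  by rewrite natrM mulr_natr; apply/eqP.
apply/nat_solE; apply: (@chang_sol_transfer G rat_osp _ _ u).
  by move=> g gL; apply: hw; rewrite mem_cat gL.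
have := efd_sol_hom hf hz; congr (efd_sol _ _ _ _); apply/funext => i /=.
  by rewrite rep_theta // /efd_x ux.
by rewrite /efd_z uz -surjective_pairing.
Qed.

(* Multiplication by [N] being an endomorphism, uniqueness of the solution [z] at
   the multiples of [r] forces [N z_j = w_j r]; a factor [p] of the reduced
   denominator would make [r] divisible by [p]. *)
Lemma nat_sol_integral p beta gamma (w : nat -> nat) N : prime p ->
  (forall y, t_ p y <> r) -> (0 < N)%N ->
  (forall i : 'I_n, exists v, w i = (N * v)%N) -> nat_sol beta gamma w ->
  forall j : 'I_m.+1, p_int p ((w (n + j)%N)%:R / N%:R).
Proof.
move=> pp nd N0 /choice[v wv] hw j.
have p0 := prime_gt0 pp.
pose x : 'I_n -> chang_nat := fun i => (beta i, v i).
have hr := theta_hom HA rr.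
have [z [hz _]] := sat (theta r \o x).
have [z1 [_ uz]] := sat (@t_ A N \o (theta r \o x)).
have e1 := uz _ (efd_sol_hom (t_hom HA N0) hz).
have e2 : z1 = theta r \o efd_z gamma w.
  apply: uz.
  have -> : @t_ A N \o (theta r \o x) = theta r \o efd_x beta w.
    apply/funext => i; apply: rep_eq => // G f rf; rewrite /= (hom_t (rep_hom rf)).
    rewrite !rep_theta // chang_tE ?opos_muln ?(rep_pos rf) //.
    by rewrite /chang_scale /chang_of_nat /= -mulrnA wv mulnC.
  exact: efd_sol_hom.
have zE (G : osp) (f : A -> chang (@opos G)) : is_rep f ->
    (f (z j)).1 = gamma j /\ (f (z j)).2 *+ N = (f r).2 *+ w (n + j)%N.
  move=> rf; have := congr1 (fun g => f (g j)) (etrans (esym e1) e2).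
  rewrite /= (hom_t (rep_hom rf)) chang_tE ?(rep_pos rf) // rep_theta //.
  by move=> [-> ->].
set h := w (n + j)%N in zE *.
have [h0|h0] := posnP h.
  exists 1%N, 0; rewrite h0 mul0r mulr0; split=> //.
  by rewrite dvdn1; apply/eqP => p1; rewrite p1 in pp.
pose g := gcdn h N; have g0 : (0 < g)%N by rewrite gcdn_gt0 h0.
pose c := (h %/ g)%N; pose d := (N %/ g)%N.
have hE : h = (c * g)%N by rewrite divnK // dvdn_gcdl.
have NE : N = (d * g)%N by rewrite divnK // dvdn_gcdr.
have c0 : (0 < c)%N by move: h0; rewrite hE muln_gt0 => /andP[].
have cd : coprime c d.
  by rewrite /coprime -(eqn_pmul2r g0) muln_gcdl -hE -NE mul1n.
have zE' (G : osp) (f : A -> chang (@opos G)) : is_rep f -> (f (z j)).2 *+ d = (f r).2 *+ c.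
  by move=> /zE[_ e]; apply: (mulrn_oinj g0); rewrite -!mulrnA -hE -NE.
have [pd|npd] := boolP (p %| d)%N; last first.
  exists d, c; split=> //.
  rewrite hE NE !natrM -pmulrn invfM mulrACA divff ?mulr1 ?pnatr_eq0 -?lt0n //.
  rewrite mulrCA divff ?mulr1 // pnatr_eq0 -lt0n.
  by move: N0; rewrite NE muln_gt0 => /andP[].
have [d' dE] := dvdnP pd.
have cp : coprime c p by apply: coprime_dvdr cd.
have [[a b] /= ab] := coprimeP p c0 cp.
pose zj : A := if gamma j then mvneg (z j) else z j.
exfalso; apply: (nd (monus (mvmuln (a * d') zj) (mvmuln b r))).
apply: rep_eq => // G f rf; have hf := rep_hom rf.
rewrite (hom_t hf) (hom_sub hf) !(hom_muln hf).
have [zg _] := zE _ _ rf; have zd := zE' _ _ rf.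
have -> : f zj = (false, (f (z j)).2).
  move: zg; rewrite /zj; case: (gamma j); rewrite ?(homN hf); by case: (f (z j)) => ? ? /= ->.
have hrho := rep_pos rf r.
have -> : f r = (false, (f r).2) by move: (rr rf); case: (f r) => ? ? /= ->.
set rho := (f r).2 in zd hrho *.
set y := (f (z j)).2 in zd *.
have yE : (y *+ (a * d') - rho *+ b) *+ p = rho.
  rewrite mulrnBl -!mulrnA -mulnA -dE mulnC mulrnA zd -mulrnA [(c * a)%N]mulnC.
  by rewrite -mulrnBr ?ab // ltnW // -subn_gt0 ab.
have yp : opos (y *+ (a * d') - rho *+ b) by rewrite -(opos_mulnE _ p0) yE.
rewrite !chang_muln_f.
have -> : monus ((false, y *+ (a * d')) : chang (@opos G)) (false, rho *+ b) =
    (false, y *+ (a * d') - rho *+ b) by rewrite /monus /= /chang_add /= yp.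
by rewrite chang_t // yE.
Qed.
End EfdSolutions.

(** * Existence and uniqueness in divisible chains *)

Section LexPoly.
Variables (G : osp) (g : nat -> G).
Hypothesis hg : forall i, opos (g i).
Notation val c := (form_eval g c).
Notation pQ := (map_poly (intr : int -> rat)).
Implicit Types (f : {poly rat}) (c : {poly int}).

Lemma map_intr_inj : injective pQ.
Proof. by apply: map_inj_poly => //; exact: intr_inj. Qed.

Lemma poly_denominator f : exists (N : nat) c, (0 < N)%N /\ f *+ N = pQ c.
Proof.
have [q [a a0 fE]] := rat_poly_scale f.
exists (absz a), (q *~ sgz a); split; first by rewrite absz_gt0.
rewrite fE rmorphMz /= pmulrn abszEsg [sgz a * a]mulrC mulrzA; congr (_ *~ _).
by rewrite -scaler_int scalerA divff ?intr_eq0 // scale1r.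
Qed.

(* Lexicographic refinement of the preorder that [g] induces on formal
   combinations: generators are made linearly independent. *)
Definition lexpos : pred {poly rat} := fun f =>
  `[< exists (N : nat) c, [/\ (0 < N)%N, f *+ N = pQ c, opos (val c) &
        val c = 0 -> 0 <= lead_coef f] >].

Lemma lexposP f N c : (0 < N)%N -> f *+ N = pQ c ->
  reflect (opos (val c) /\ (val c = 0 -> 0 <= lead_coef f)) (lexpos f).
Proof.
move=> N0 fN; apply: (iffP (asboolP _)) => [[N' [c' [N'0 fN' h1 h2]]]|[h1 h2]].
  have e : val c *+ N' = val c' *+ N.
    rewrite -!form_evalMn; congr (val _); apply: map_intr_inj.
    by rewrite !rmorphMn /= -fN -fN' -!mulrnA mulnC.
  split; first by rewrite -(opos_mulnE _ N'0) e opos_muln.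
  move=> c0; apply: h2; move: e; rewrite c0 mul0rn => /esym/eqP.
  by rewrite mulrn_oeq0 // => /eqP.
by exists N, c.
Qed.

Lemma lead_coefD_ge0 f f' : 0 <= lead_coef f -> 0 <= lead_coef f' -> 0 <= lead_coef (f + f').
Proof.
move=> h h'; have [k|k|k] := ltngtP (size f) (size f').
- by rewrite addrC lead_coefDl.
- by rewrite lead_coefDl.
have [->|f0] := eqVneq f 0; first by rewrite add0r.
have [->|f'0] := eqVneq f' 0; first by rewrite addr0.
have p : 0 < (f + f')`_(size f).-1.
  rewrite coefD {2}k -!lead_coefE addr_gt0 // lt_def ?lead_coef_eq0 ?f0 ?f'0 //.
have se : size (f + f') = size f.
  apply/eqP; rewrite eqn_leq (leq_trans (size_polyD _ _)) ?geq_max ?k ?leqnn //=.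
  rewrite -k -[X in (X <= _)%N]prednK ?size_poly_gt0 //.
  by rewrite ltnNge; apply/negP => /leq_sizeP/(_ _ (leqnn _)) e; rewrite e ltxx in p.
by rewrite lead_coefE se ltW.
Qed.

Lemma lexposD f f' : lexpos f -> lexpos f' -> lexpos (f + f').
Proof.
have [N [c [N0 e]]] := poly_denominator f; have [N' [c' [N'0 e']]] := poly_denominator f'.
move=> /(lexposP N0 e)[h1 h2] /(lexposP N'0 e')[h1' h2'].
have NN : (0 < N * N')%N by rewrite muln_gt0 N0.
apply/(@lexposP _ _ (c *+ N' + c' *+ N) NN).
  by rewrite rmorphD !rmorphMn /= -e -e' mulrnDl mulrnA [in X in _ + X]mulnC mulrnA.
rewrite form_evalD !form_evalMn; split; first by apply: oposD; exact: opos_muln.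
move=> z; have z1 := oposD_eq0 (opos_muln N' h1) (opos_muln N h1') z.
move: z; rewrite z1 add0r => /eqP; rewrite mulrn_oeq0 // => /eqP z2.
move/eqP: z1; rewrite mulrn_oeq0 // => /eqP z1.
by apply: lead_coefD_ge0; [exact: h2|exact: h2'].
Qed.
Lemma lexpos_anti f : lexpos f -> lexpos (- f) -> f = 0.
Proof.
have [N [c [N0 e]]] := poly_denominator f.
have e' : (- f) *+ N = pQ (- c) by rewrite mulNrn e rmorphN.
move=> /(lexposP N0 e)[h1 h2] /(lexposP N0 e').
rewrite form_evalN lead_coefN oppr_ge0 => -[h3 h4].
have v0 := opos_anti h1 h3; apply/eqP; rewrite -lead_coef_eq0 eq_le h2 // h4 //.
by rewrite v0 oppr0.
Qed.
Lemma lexpos_total f : lexpos f || lexpos (- f).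
Proof.
have [N [c [N0 e]]] := poly_denominator f.
have e' : (- f) *+ N = pQ (- c) by rewrite mulNrn e rmorphN.
have [v0|v0] := eqVneq (val c) 0.
  have p0 : opos (0 : G) := opos0 G.
  have [h|h] := leP 0 (lead_coef f).
    by apply/orP; left; apply/(lexposP N0 e); rewrite v0.
  apply/orP; right; apply/(lexposP N0 e'); rewrite form_evalN v0 oppr0 lead_coefN oppr_ge0.
  by rewrite ltW.
have := opos_total (val c) => /orP[h|h]; apply/orP; [left|right].
  by apply/(lexposP N0 e); split=> // z; rewrite z eqxx in v0.
apply/(lexposP N0 e'); rewrite form_evalN; split=> // /eqP.
by rewrite oppr_eq0 (negbTE v0).
Qed.
Definition lex_osp : osp := Osp lexposD lexpos_anti lexpos_total.

Definition lexX (i : nat) : lex_osp := ('X^i : {poly rat}).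

Lemma lexX_eval c : form_eval lexX c = pQ c.
Proof.
rewrite -[in RHS](coefK c) poly_def rmorph_sum /=; apply: eq_bigr => i _.
by rewrite linearZ /= map_polyXn /lexX -scaler_int.
Qed.
Lemma lexX_pos i : opos (lexX i).
Proof.
have e : ('X^i : {poly rat}) *+ 1 = pQ 'X^i by rewrite map_polyXn.
by apply/(lexposP (ltn0Sn 0) e); rewrite form_evalX hg lead_coefXn.
Qed.
Lemma lex_divisible : osp_divisible lex_osp.
Proof.
move=> d f d0; exists ((d%:R^-1 : rat) *: f).
by rewrite -scaler_nat scalerA divff ?scale1r // pnatr_eq0 -lt0n.
Qed.
Lemma lex_unit_pos : ~~ opos (- (1 : {poly rat}) : lex_osp).
Proof.
apply/negP => h; have := lexX_pos 0; rewrite /lexX expr0 => h1.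
by have /eqP := lexpos_anti h1 h; rewrite oner_eq0.
Qed.

Definition lexval f (x : G) : Prop :=
  exists (N : nat) c, [/\ (0 < N)%N, f *+ N = pQ c & x *+ N = val c].

Lemma lexval_pos f x : lexval f x -> lexpos f -> opos x.
Proof.
move=> [N [c [N0 e xE]]] /(lexposP N0 e)[h _].
by rewrite -(opos_mulnE _ N0) xE.
Qed.
Lemma lexval_fun f x x' : lexval f x -> lexval f x' -> x = x'.
Proof.
move=> [N [c [N0 e xE]]] [N' [c' [N'0 e' xE']]].
have NN : (0 < N * N')%N by rewrite muln_gt0 N0.
apply: (mulrn_oinj NN); rewrite mulrnA xE mulnC mulrnA xE' -!form_evalMn; congr (val _).
by apply: map_intr_inj; rewrite !rmorphMn /= -e -e' -!mulrnA mulnC.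
Qed.
Lemma lexvalD f x f' x' : lexval f x -> lexval f' x' -> lexval (f + f') (x + x').
Proof.
move=> [N [c [N0 e xE]]] [N' [c' [N'0 e' xE']]].
exists (N * N')%N, (c *+ N' + c' *+ N); split; first by rewrite muln_gt0 N0.
  by rewrite rmorphD !rmorphMn /= -e -e' mulrnDl mulrnA [in X in _ + X]mulnC mulrnA.
by rewrite form_evalD !form_evalMn -xE -xE' mulrnDl mulrnA [in X in _ + X]mulnC mulrnA.
Qed.
Lemma lexvalN f x : lexval f x -> lexval (- f) (- x).
Proof.
move=> [N [c [N0 e xE]]]; exists N, (- c); split=> //.
  by rewrite mulNrn e rmorphN.
by rewrite mulNrn xE form_evalN.
Qed.
Lemma lexval0 : lexval 0 0.
Proof. by exists 1%N, 0; rewrite rmorph0 form_eval0. Qed.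
Lemma lexvalX i : lexval 'X^i (g i).
Proof. by exists 1%N, 'X^i; rewrite map_polyXn form_evalX. Qed.

Lemma lexval_max f x : lexval f x ->
  lexval (if lexpos f then f else 0) (if opos x then x else 0).
Proof.
move=> h; case: ifP => hf; first by rewrite (lexval_pos h hf).
have hf' : lexpos (- f) by have := lexpos_total f; rewrite hf.
have xN := lexval_pos (lexvalN h) hf'.
case: ifP => hx; last exact: lexval0.
by rewrite (opos_anti hx xN); exact: lexval0.
Qed.

Lemma lexval_eval V (y : V -> bool * {poly rat}) (y' : V -> bool * G) (t : term V) :
  (forall v, (y v).1 = (y' v).1 /\ lexval (y v).2 (y' v).2) ->
  let a := @eval (chang lexpos) V y t in
  let b := @eval (chang (@opos G)) V y' t in a.1 = b.1 /\ lexval a.2 b.2.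
Proof.
move=> h; elim: t => [v|t1 IH1 t2 IH2|t1 IH1|] /=; first exact: h.
- move: IH1 IH2; rewrite /= /chang_add.
  case: (@eval (chang lexpos) V y t1) (@eval (chang (@opos G)) V y' t1) => [b f] [b1 x] /= [<- hx].
  case: (@eval (chang lexpos) V y t2) (@eval (chang (@opos G)) V y' t2) =>
    [c f'] [c1 x'] /= [<- hx'].
  case: b c => [] [] /=; split=> //.
  + exact: lexval0.
  + exact: lexval_max (lexvalD hx (lexvalN hx')).
  + exact: lexval_max (lexvalD hx' (lexvalN hx)).
  + exact: lexvalD.
- by move: IH1; case: (@eval (chang lexpos) V y t1) (@eval (chang (@opos G)) V y' t1) =>
    [b f] [b1 x] /= [<-].
- by split=> //; exact: lexval0.
Qed.
End LexPoly.

Lemma p_intB p (x y : rat) : prime p -> p_int p x -> p_int p y -> p_int p (x - y).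
Proof.
move=> pp [N [c [hN e]]] [N' [c' [hN' e']]].
exists (N * N')%N, (c * N'%:Z - c' * N%:Z); split.
  by rewrite Euclid_dvdM // negb_or hN.
by rewrite natrM mulrBr rmorphB !rmorphM /= -e -e' -!pmulrn; ring.
Qed.
Lemma p_int_natmul p (x : rat) (M : nat) : p_int p x -> p_int p (M%:R * x).
Proof.
move=> [N [c [hN e]]]; exists N, (c * M%:Z); split=> //.
by rewrite rmorphM /= -e -pmulrn; ring.
Qed.
Lemma p_int_denq p x : prime p -> p_int p x -> ~~ (p %| absz (denq x))%N.
Proof.
move=> pp [N [c [hN e]]]; apply: contra hN => pd.
have e2 : N%:Z * numq x = c * denq x.
  apply/eqP; rewrite -(eqr_int rat) !rmorphM /= -e.
  by rewrite -[X in _ == _ * X * _]divq_num_den mulrA divfK ?intr_eq0 ?denq_neq0 // -pmulrn.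
have cp : coprime p (absz (numq x)).
  by apply: coprime_dvdl pd _; rewrite coprime_sym coprime_num_den.
have := congr1 absz e2; rewrite !abszM absz_nat => e3.
by rewrite -(Gauss_dvdl _ cp) e3 dvdn_mull.
Qed.

Lemma form_evalDl (V : zmodType) (u v : nat -> V) f :
  form_eval (fun i => u i + v i) f = form_eval u f + form_eval v f.
Proof. by rewrite /form_eval -big_split; apply: eq_bigr => i _; rewrite mulrzDl. Qed.

Lemma form_eval_delta (l : nat) (c : {poly int}) :
  form_eval (fun i => (i == l)%:R : rat) c = (c`_l)%:~R.
Proof.
rewrite (form_eval_widen _ (leq_maxl (size c) l.+1)).
rewrite (bigD1 (Ordinal (leq_maxr (size c) l.+1 : (l < _)%N))) //= eqxx big1 ?addr0 //.
by move=> i il; rewrite -(inj_eq val_inj) /= in il; rewrite (negbTE il) mul0rz.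
Qed.

Lemma form_eval_natQ_int w (c : {poly int}) : exists e : int,
  form_eval (natQ w) c = e%:~R :> rat.
Proof.
exists (\sum_(i < size c) (w i)%:Z * c`_i); rewrite rmorph_sum; apply: eq_bigr => i _.
by rewrite rmorphM /= -pmulrn mulrzr.
Qed.

Lemma sgn_dominate (M e a : int) : `|a| < M -> e != 0 -> (0 <= M * e + a) = (0 <= e).
Proof. by move=> h e0; apply/idP/idP => h'; nia. Qed.

Lemma smooth_divisible (S : set nat) (G : osp) N :
  (forall p, prime p -> S p -> forall x : G, exists y, y *+ p = x) ->
  (0 < N)%N -> (forall p, prime p -> (p %| N)%N -> S p) ->
  forall x : G, exists y, y *+ N = x.
Proof.
move=> Gd; elim/ltn_ind: N => N IH N0 hN x.
have [N1|N1] := leqP N 1.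
  by exists x; have -> : N = 1%N by apply/eqP; rewrite eqn_leq N1.
have pp := pdiv_prime N1; have pN := pdiv_dvd N.
have [y yx] := Gd _ pp (hN _ pp pN) x.
have NE := divnK pN.
have N'0 : (0 < N %/ pdiv N)%N by rewrite divn_gt0 ?prime_gt0 // dvdn_leq.
have [||z zy] := IH (N %/ pdiv N)%N _ N'0 _ y.
- by rewrite ltn_Pdiv // prime_gt1.
- by move=> q qp qN; apply: hN => //; rewrite -NE dvdn_mulr.
by exists z; rewrite -NE mulrnA zy.
Qed.

Lemma smooth_denominator (S : set nat) (f : {poly rat}) :
  (forall p, prime p -> ~ S p -> forall l, p_int p f`_l) ->
  exists N (c : {poly int}), [/\ (0 < N)%N, forall p, prime p -> (p %| N)%N -> S p &
    f *+ N = map_poly intr c].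
Proof.
move=> hf; pose N := (\prod_(l < size f) absz (denq f`_l))%N.
have N0 : (0 < N)%N by apply: prodn_gt0 => l; rewrite absz_gt0 denq_eq0.
have hN p : prime p -> (p %| N)%N -> S p.
  move=> pp; apply: contraPP => nS; apply/negP; rewrite /N.
  elim/big_ind: _ => [|a b ha hb|l _]; first by rewrite dvdn1 neq_ltn prime_gt1 ?orbT.
    by rewrite Euclid_dvdM // negb_or ha.
  by apply: p_int_denq => //; exact: hf.
have /choice[c hc] l : exists a : int, (l < size f)%N -> f`_l *+ N = a%:~R.
  have [lf|] := boolP (l < size f)%N; last by exists 0.
  have : (absz (denq f`_l) %| N)%N by rewrite /N (bigD1 (Ordinal lf)) //= dvdn_mulr.
  move=> /dvdnP[d ->]; exists (numq f`_l * d%:Z) => _.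
  rewrite mulnC mulrnA rmorphM /= -pmulrn mulr_natr; congr (_ *+ _).
  by rewrite numqE -[LHS]mulr_natr pmulrn gez0_abs ?denq_ge0.
exists N, (\poly_(l < size f) c l); split=> //.
apply/polyP => l; rewrite coefMn coef_map coef_poly /=.
by case: ltnP => [/hc//|h]; rewrite nth_default // mul0rn.
Qed.

Section Existence.
Variables (n m k : nat) (s t : 'I_k.+1 -> term ('I_n + 'I_m.+1)).
Variable S : set nat.
Hypothesis nat_ex : forall beta (v : 'I_n -> nat), exists N (w : nat -> nat) gamma,
  [/\ (0 < N)%N, forall i : 'I_n, w i = (N * v i)%N & nat_sol s t beta gamma w].
Hypothesis nat_int : forall p beta gamma (w : nat -> nat) N, prime p -> ~ S p ->
  (0 < N)%N -> (forall i : 'I_n, exists v, w i = (N * v)%N) ->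
  nat_sol s t beta gamma w -> forall j : 'I_m.+1, p_int p ((w (n + j)%N)%:R / N%:R).

Lemma rat_sol_integral beta gamma (q : nat -> rat_osp) :
  chang_sol s t beta gamma q -> (forall i : 'I_n, exists v : nat, q i = v%:R :> rat) ->
  (forall j : 'I_m.+1, 0 <= q (n + j)%N :> rat) ->
  forall p, prime p -> ~ S p -> forall j : 'I_m.+1, p_int p (q (n + j)%N).
Proof.
move=> hq /choice[v qv] q0 p pp nS j.
pose K := (n + m.+1)%N.
have qK i : (i < K)%N -> 0 <= q i :> rat.
  move=> iK; have [h|h] := ltnP i n; first by rewrite (qv (Ordinal h)) ler0n.
  have jm : (i - n < m.+1)%N by rewrite ltn_subLR.
  by have := q0 (Ordinal jm); rewrite /= subnKC.
have [N N0 hN] := common_denominator q K.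
have /choice[w hw] i : exists w : nat, (i < K)%N -> N%:R * q i = w%:R :> rat.
  have [iK|] := boolP (i < K)%N; last by exists 0%N.
  by have [w hw] := hN i iK (qK i iK); exists w.
have qN i : (i < K)%N -> q i *+ N = natQ w i.
  by move=> iK; exact: (etrans (esym (mulr_natl (q i : rat) N)) (hw i iK)).
have ns : nat_sol s t beta gamma w.
  apply/nat_solE; rewrite /chang_sol.
  have -> : efd_x beta (natQ w) = chang_scale N \o efd_x beta q.
    apply/funext => i; congr (_, _); apply/esym/qN.
    by rewrite (leq_trans (ltn_ord i)) // leq_addr.
  have -> : efd_z n gamma (natQ w) = chang_scale N \o efd_z n gamma q.
    by apply/funext => i; congr (_, _); apply/esym/qN; rewrite ltn_add2l.
  exact: efd_sol_hom (chang_scale_hom rat_osp N0) hq.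
have <- : (w (n + j)%N)%:R / N%:R = q (n + j)%N :> rat.
  rewrite -hw ?ltn_add2l // mulrAC divff ?mul1r // pnatr_eq0 -lt0n //.
apply: nat_int ns j => // i; exists (v i).
apply/eqP; rewrite -(eqr_nat rat) -hw ?natrM ?qv //.
by rewrite (leq_trans (ltn_ord i)) // leq_addr.
Qed.

Variables (G : osp) (g : nat -> G) (beta : 'I_n -> bool).
Hypothesis hg : forall i, opos (g i).

Let tests : seq {poly int} := efd_tests s t ++ [seq 'X^(n + val j) | j <- enum 'I_m.+1].

Lemma var_in_tests (j : 'I_m.+1) : 'X^(n + j) \in tests.
Proof. by rewrite mem_cat; apply/orP; right; apply/mapP; exists j; rewrite ?mem_enum. Qed.

Lemma size_bound (R : nzRingType) (L : seq {poly R}) :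
  exists K, forall f : {poly R}, f \in L -> (size f <= K)%N.
Proof.
elim: L => [|f L [K hK]]; first by exists 0%N.
exists (maxn (size f) K) => h; rewrite inE leq_max => /predU1P[->|/hK ->].
  by rewrite leqnn.
by rewrite orbT.
Qed.

Lemma lex_solution : exists gamma (h : nat -> lex_osp g),
  [/\ forall i, (i < n)%N -> h i = lexX g i,
      forall j : 'I_m.+1, opos (h (n + j)%N) & chang_sol s t beta gamma h].
Proof.
have [K hK] := size_bound tests.
have [|L [hL hA]] := @form_agree_steps n K tests.
  by move=> f /hK h; apply: leq_trans h _; exact: leq_addl.
have [w0 hw0] := form_agree_nat L (lexX_pos hg).
have [N [w [gamma [N0 wN hw]]]] := nat_ex beta (fun i => w0 i).
have hw1 : form_agree L (natQ w) (lexX g).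
  move=> f fL; rewrite hw0 //.
  have -> : form_eval (natQ w) f = N%:R * (form_eval (natQ w0) f : rat) :> rat.
    rewrite -form_eval_mul; apply: eq_form_eval (hL f fL) _ => i ik.
    by rewrite /natQ (wN (Ordinal ik)) natrM.
  by rewrite /opos /= pmulr_rge0 ?ltr0n.
have [h [hX hh]] := hA _ _ _ _ _ (@lex_divisible G g) (lex_unit_pos hg) hw1.
exists gamma, h; split=> //.
  move=> j; have e := hh 'X^(n + j); rewrite !form_evalX in e; rewrite -e.
    by rewrite /opos /= /natQ ler0n.
  exact: var_in_tests.
apply: (@chang_sol_transfer _ _ _ s t rat_osp _ _ _ (natQ w)); last exact/nat_solE.
by move=> f fL; apply: hh; rewrite mem_cat fL.
Qed.

Section Integrality.
Variables (gamma : 'I_m.+1 -> bool) (h : nat -> lex_osp g).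
Hypotheses (hX : forall i, (i < n)%N -> h i = lexX g i)
  (hpos : forall j : 'I_m.+1, opos (h (n + j)%N)) (hsol : chang_sol s t beta gamma h).
Variable K : nat.

Definition poly_at (psi : nat -> nat) (f : {poly rat}) : rat :=
  \sum_(i < K) f`_i * (psi i)%:R.

Lemma poly_at_form psi f :
  form_eval (fun i => poly_at psi (h i)) f = poly_at psi (form_eval h f).
Proof.
rewrite /poly_at.
transitivity (\sum_(l < K) \sum_(i < size f) (h i *~ f`_i : {poly rat})`_l * (psi l)%:R).
  rewrite exchange_big /=; apply: eq_bigr => i _; rewrite mulrz_suml; apply: eq_bigr => l _.
  by rewrite coefMrz mulrzAl.
by apply: eq_bigr => l _; rewrite /form_eval coef_sum mulr_suml.
Qed.
Lemma poly_at_muln psi f N : poly_at psi (f *+ N) = poly_at psi f *+ N.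
Proof. by rewrite /poly_at -sumrMnl; apply: eq_bigr => i _; rewrite coefMn mulrnAl. Qed.
Lemma poly_at_int psi (c : {poly int}) : (size c <= K)%N ->
  poly_at psi (map_poly intr c) = form_eval (natQ psi) c.
Proof.
move=> cK; rewrite (form_eval_widen _ cK); apply: eq_bigr => i _.
by rewrite coef_map /= mulrzl.
Qed.
Lemma poly_atX psi i : (i < K)%N -> poly_at psi 'X^i = (psi i)%:R.
Proof.
move=> iK; rewrite /poly_at (bigD1 (Ordinal iK)) //= coefXn eqxx mul1r big1 ?addr0 //.
by move=> l li; rewrite coefXn -(inj_eq val_inj) /= in li *; rewrite (negbTE li) mul0r.
Qed.

Variables (den : {poly int} -> nat) (num : {poly int} -> {poly int}).
Hypotheses (den0 : forall f, (0 < den f)%N)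
  (denE : forall f, form_eval h f *+ den f = map_poly intr (num f) :> {poly rat})
  (nK : (n <= K)%N) (numK : forall f, f \in tests -> (size (num f) <= K)%N).

Lemma poly_at_integral psi p (j : 'I_m.+1) : prime p -> ~ S p ->
  form_agree [seq num f | f <- tests] (lexX g) (natQ psi) -> p_int p (poly_at psi (h (n + j)%N)).
Proof.
move=> pp nS hpsi.
pose q i : rat_osp := poly_at psi (h i).
have agree : form_agree tests h q.
  move=> f ft; rewrite -(opos_mulnE _ (den0 f)) -[RHS](opos_mulnE _ (den0 f)).
  rewrite denE -lexX_eval hpsi ?map_f //.
  rewrite -(poly_at_int _ (numK ft)) -denE poly_at_muln; congr (opos (_ *+ _)).
  by rewrite -poly_at_form.
apply: (@rat_sol_integral beta gamma q) => //.
- apply: chang_sol_transfer hsol => f ft; apply: agree; by rewrite mem_cat ft.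
- by move=> i; exists (psi i); rewrite /q hX // /lexX poly_atX // (leq_trans (ltn_ord i)).
- move=> l; have e := agree 'X^(n + l); rewrite !form_evalX in e.
  by apply: (esym (etrans (esym (hpos l)) (e _))); exact: var_in_tests.
Qed.

End Integrality.

(* The point [M phi + delta_l] satisfies the same strict inequalities as [phi] for
   large [M], and subtracting [M] times the value at [phi] isolates the l-th
   coefficient. *)
Lemma coef_integral gamma (h : nat -> lex_osp g) :
  (forall i, (i < n)%N -> h i = lexX g i) ->
  (forall j : 'I_m.+1, opos (h (n + j)%N)) -> chang_sol s t beta gamma h ->
  forall p, prime p -> ~ S p ->
  forall (j : 'I_m.+1) l, p_int p (h (n + j)%N : {poly rat})`_l.
Proof.
move=> hX hpos hsol p pp nS j l.
have /choice[dn dnE] f := poly_denominator (form_eval h f : {poly rat}).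
have /choice[num numE] := dnE.
pose C := [seq num f | f <- tests].
have [K1 hK1] := size_bound C.
pose K := maxn (maxn n l.+1) (maxn K1 (size (h (n + j)%N : {poly rat}))).
have nK : (n <= K)%N by rewrite /K !leq_max leqnn.
have lK : (l < K)%N by rewrite /K !leq_max leqnn orbT.
have numK f : f \in tests -> (size (num f) <= K)%N.
  by move=> ft; rewrite /K !leq_max hK1 ?orbT // map_f.
have integral psi : form_agree C (lexX g) (natQ psi) ->
    p_int p (poly_at K psi (h (n + j)%N)).
  apply: (poly_at_integral hX hpos hsol (den := dn) (num := num)) => // f.
    by case: (numE f).
  by case: (numE f).
have [phi hphi] := form_agree_nat (C ++ [seq - c | c <- C]) (lexX_pos hg).
have hphi1 : form_agree C (lexX g) (natQ phi).
  by move=> c cC; apply: hphi; rewrite mem_cat cC.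
have [M hM] : exists M : nat, forall c, c \in C -> `|c`_l| < M%:Z.
  elim: C {hK1 integral hphi hphi1} => [|c C [M hM]]; first by exists 0%N.
  exists (maxn M (absz c`_l).+1) => c'; rewrite inE => /predU1P[->|/hM h'].
    by rewrite -abszE ltz_nat leq_max ltnSn orbT.
  by apply: lt_le_trans h' _; rewrite lez_nat leq_maxl.
pose psi i := (M * phi i + (i == l))%N.
have psiE (c : {poly int}) : form_eval (natQ psi) c =
    M%:R * (form_eval (natQ phi) c : rat) + (c`_l)%:~R :> rat.
  rewrite -form_eval_mul -form_eval_delta -form_evalDl; apply: eq_bigr => i _.
  by rewrite /natQ /psi natrD natrM.
have hpsi : form_agree C (lexX g) (natQ psi).
  move=> c cC; rewrite hphi1 // /opos /=.
  have [e eE] := form_eval_natQ_int phi c.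
  have [c0|c0] := eqVneq c 0; first by rewrite c0 !form_eval0.
  have e0 : e != 0.
    apply/eqP => e0; move/eqP: c0; apply; apply: map_intr_inj; rewrite rmorph0 -(lexX_eval g).
    have pe : opos (form_eval (lexX g) c) by rewrite hphi1 // /opos /= eE e0.
    have pm : opos (- form_eval (lexX g) c).
      rewrite -form_evalN hphi; first by rewrite form_evalN /opos /= eE e0 oppr0.
      by rewrite mem_cat map_f ?orbT.
    exact: (opos_anti pe pm).
  rewrite eE psiE eE pmulrn -rmorphM -rmorphD !ler0z.
  by rewrite sgn_dominate // hM.
have -> : (h (n + j)%N : {poly rat})`_l =
    poly_at K psi (h (n + j)%N) - M%:R * poly_at K phi (h (n + j)%N).
  rewrite /poly_at mulr_sumr -sumrB (bigD1 (Ordinal lK)) //= big1 => [|i il].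
    by rewrite /psi eqxx /= addn1 -natr1 natrM addr0; ring.
  by rewrite -(inj_eq val_inj) /= in il; rewrite /psi (negbTE il) addn0 natrM; ring.
by apply: p_intB => //; [exact: integral|apply: p_int_natmul; exact: integral].
Qed.

Hypothesis Gdiv : forall p, prime p -> S p -> forall x : G, exists y, y *+ p = x.

Lemma chang_sol_exists : exists gamma (u : nat -> G),
  [/\ forall i, (i < n)%N -> u i = g i, forall j : 'I_m.+1, opos (u (n + j)%N) &
      chang_sol s t beta gamma u].
Proof.
have [gamma [h [hX hpos hsol]]] := lex_solution.
have /choice[x hx] (j : 'I_m.+1) : exists x, lexval g (h (n + j)%N) x.
  have [N [c [N0 hN e]]] := smooth_denominator (fun p pp nS => coef_integral hX hpos hsol pp nS j).
  have [x xE] := smooth_divisible Gdiv N0 hN (form_eval g c).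
  by exists x, N, c.
pose u i := if (i < n)%N then g i else x (inord (i - n)).
have uz (j : 'I_m.+1) : u (n + j)%N = x j.
  by rewrite /u ltnNge leq_addr addKn inord_val.
exists gamma, u; split.
- by move=> i ik; rewrite /u ik.
- by move=> j; rewrite uz; exact: lexval_pos (hx j) (hpos j).
move=> i.
have R r : let a := @eval (chang (lexpos g)) _ (sum_env (efd_x beta h) (efd_z n gamma h)) r in
    let b := @eval (chang (@opos G)) _ (sum_env (efd_x beta u) (efd_z n gamma u)) r in
    a.1 = b.1 /\ lexval g a.2 b.2.
  apply: lexval_eval => -[l|j] /=; split=> //; last by rewrite uz.
  by rewrite /u ltn_ord hX //; exact: lexvalX.
have [e1 e2] := R (s i); have [e3 e4] := R (t i).
have e := hsol i; rewrite /= in e1 e2 e3 e4.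
rewrite [LHS]surjective_pairing [RHS]surjective_pairing -e1 -e3 e; congr (_, _).
by apply: (lexval_fun e2); rewrite e.
Qed.
End Existence.

Lemma chang_eval_natQ V (idx : V -> nat) beta w (t1 t2 : term V) :
  chang_eval idx beta (natQ w) t1 = chang_eval idx beta (natQ w) t2 ->
  @eval chang_nat V (fun v => (beta v, w (idx v))) t1 =
  @eval chang_nat V (fun v => (beta v, w (idx v))) t2.
Proof.
have h1 : opos (1 : rat_osp) by [].
have E r : chang_eval idx beta (natQ w) r = chang_of_nat (1 : rat_osp)
    (@eval chang_nat V (fun v => (beta v, w (idx v))) r).
  by rewrite hom_eval //; exact: chang_of_nat_hom.
by rewrite !E; apply: chang_of_nat_inj.
Qed.

Section Uniqueness.
Variables (n m k : nat) (s t : 'I_k.+1 -> term ('I_n + 'I_m.+1)).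
Hypothesis nat_uniq : forall (x : 'I_n -> chang_nat) (z z' : 'I_m.+1 -> chang_nat),
  efd_sol s t x z -> efd_sol s t x z' -> z = z'.
Variable G : osp.

Lemma chang_sol_uniq (x : 'I_n -> chang (@opos G)) (z z' : 'I_m.+1 -> chang (@opos G)) :
  (forall i, opos (x i).2) -> (forall j, opos (z j).2) -> (forall j, opos (z' j).2) ->
  efd_sol s t x z -> efd_sol s t x z' -> forall j, z j = z' j.
Proof.
move=> hx hz hz' sz sz' j.
pose M := (n + m.+1)%N.
pose u i : G := if (i < n)%N then oapp (fun l => (x l).2) 0 (insub i) else
  if (i < M)%N then (z (inord (i - n))).2 else (z' (inord (i - M))).2.
pose beta i := (x i).1; pose gamma j := (z j).1; pose gamma' j := (z' j).1.
pose idx1 := @efd_idx n m.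
pose idx2 (v : 'I_n + 'I_m.+1) : nat := match v with inl i => i | inr j => (M + j)%N end.
have ux (i : 'I_n) : u i = (x i).2 by rewrite /u ltn_ord valK.
have uz (l : 'I_m.+1) : u (n + l)%N = (z l).2.
  by rewrite /u ltnNge leq_addr /M ltn_add2l ltn_ord addKn inord_val.
have uz' (l : 'I_m.+1) : u (M + l)%N = (z' l).2.
  have h1 : (M + l < n)%N = false by rewrite ltnNge /M -addnA leq_addr.
  have h2 : (M + l < M)%N = false by rewrite ltnNge leq_addr.
  by rewrite /u h1 h2 addKn inord_val.
have hu i : opos (u i).
  rewrite /u; case: ifP => [h|_]; first by rewrite insubT /=.
  by case: ifP.
pose tests idx := flatten [seq eq_tests idx (s i) (t i) | i <- enum 'I_k.+1].
pose d : {poly int} := 'X^(n + j) - 'X^(M + j).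
have [w hw] := form_agree_nat (tests idx1 ++ (tests idx2 ++ [:: d; - d])) hu.
have in_tests idx i f : f \in eq_tests idx (s i) (t i) -> f \in tests idx.
  by move=> h; apply/flattenP; exists (eq_tests idx (s i) (t i)) => //;
    apply/mapP; exists i; rewrite ?mem_enum.
have transfer idx gam :
    {subset tests idx <= tests idx1 ++ (tests idx2 ++ [:: d; - d])} ->
    (forall i, chang_eval idx (sum_env beta gam) u (s i) =
               chang_eval idx (sum_env beta gam) u (t i)) ->
    forall i, @eval chang_nat _ (fun v => (sum_env beta gam v, w (idx v))) (s i) =
              @eval chang_nat _ (fun v => (sum_env beta gam v, w (idx v))) (t i).
  move=> sub h i; apply: chang_eval_natQ; apply: eval_eq_transfer (h i).
  by move=> f /in_tests/sub; exact: hw.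
have s1 : efd_sol s t (efd_x beta w : 'I_n -> chang_nat) (efd_z n gamma w).
  have E r : @eval chang_nat _ (sum_env (efd_x beta w) (efd_z n gamma w)) r =
      @eval chang_nat _ (fun v => (sum_env beta gamma v, w (idx1 v))) r.
    by apply: (@eval_ext chang_nat) => -[].
  have F r : chang_eval idx1 (sum_env beta gamma) u r =
      @eval (chang (@opos G)) _ (sum_env x z) r.
    apply: (@eval_ext (chang (@opos G))) => -[l|l]; rewrite /chang_env /= ?ux ?uz;
      by rewrite -surjective_pairing.
  move=> i; rewrite !E; apply: transfer => [f hf|{}i]; first by rewrite mem_cat hf.
  by rewrite !F.
have s2 : efd_sol s t (efd_x beta w : 'I_n -> chang_nat) (efd_z M gamma' w).
  have E r : @eval chang_nat _ (sum_env (efd_x beta w) (efd_z M gamma' w)) r =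
      @eval chang_nat _ (fun v => (sum_env beta gamma' v, w (idx2 v))) r.
    by apply: (@eval_ext chang_nat) => -[].
  have F r : chang_eval idx2 (sum_env beta gamma') u r =
      @eval (chang (@opos G)) _ (sum_env x z') r.
    apply: (@eval_ext (chang (@opos G))) => -[l|l]; rewrite /chang_env /= ?ux ?uz';
      by rewrite -surjective_pairing.
  move=> i; rewrite !E; apply: transfer => [f hf|{}i]; first by rewrite !mem_cat hf orbT.
  by rewrite !F.
have /(congr1 (fun q => q j)) [ej wj] := nat_uniq s1 s2.
have e1 : opos (form_eval u d).
  rewrite hw; last by rewrite !mem_cat !inE eqxx !orbT.
  by rewrite form_evalB !form_evalX /natQ wj subrr; exact: opos0.
have e2 : opos (- form_eval u d).
  rewrite -form_evalN hw; last by rewrite !mem_cat !inE eqxx !orbT.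
  by rewrite form_evalN form_evalB !form_evalX /natQ wj subrr oppr0; exact: opos0.
have := opos_anti e1 e2; rewrite form_evalB !form_evalX uz uz' => /eqP.
rewrite subr_eq0 => /eqP e3.
by rewrite [z j]surjective_pairing [z' j]surjective_pairing e3; congr (_, _).
Qed.
End Uniqueness.

Lemma efd_satisfied n m k (s t : 'I_k.+1 -> term ('I_n + 'I_m.+1)) (S : set nat)
    (A0 : mvstr) (r : A0) :
  is_MVP A0 -> satisfies A0 (Efd s t) -> is_rad r -> r <> mvzero ->
  (forall p, prime p -> ~ S p -> exists B : mvstr,
     [/\ is_MVP B, satisfies B (Efd s t) & ~ satisfies B (epsilon p)]) ->
  forall A : mvstr, is_MVP A -> (forall p, prime p -> S p -> satisfies A (epsilon p)) ->
  satisfies A (Efd s t).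
Proof.
move=> HA0 sat0 rr r0 hB A HA hA.
have uniq := nat_sol_uniq HA0 sat0 rr r0.
have int p beta gamma (w : nat -> nat) N : prime p -> ~ S p -> (0 < N)%N ->
    (forall i : 'I_n, exists v, w i = (N * v)%N) -> nat_sol s t beta gamma w ->
    forall j : 'I_m.+1, p_int p ((w (n + j)%N)%:R / N%:R).
  move=> pp nS N0 wN hw j; have [B [HB satB nB]] := hB p pp nS.
  have [q [rq nq]] : exists q : B, is_rad q /\ forall y, t_ p y <> q.
    apply: contrapT => no; apply: nB; apply: epsilon_rad => //; first exact: prime_gt0.
    move=> q rq; apply: contrapT => nq; apply: no; exists q; split=> // y yq.
    by apply: nq; exists y.
  exact: (nat_sol_integral HB satB rq pp nq N0 wN hw).
apply: efd_local_global => // G f rf x; have hf := rep_hom rf; last first.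
  by move=> z z' h h' j; apply: (chang_sol_uniq uniq _ _ _ h h') => l; exact: rep_pos.
have Gdiv p : prime p -> S p -> forall g : G, exists y, y *+ p = g.
  move=> pp Sp; have p0 := prime_gt0 pp.
  have pos (g : G) : opos g -> exists y, y *+ p = g.
    move=> hg; have [a fa] := rep_onto rf (y := (false, g)) hg.
    have [z ez] := iffLR (epsilon_exP HA p0) (hA p pp Sp) a.
    have := congr1 f ez; rewrite (hom_t hf) chang_tE ?(rep_pos rf) // fa.
    by case=> _ e; exists (f z).2.
  move=> g; have /orP[/pos //|/pos[y e]] := opos_total g.
  by exists (- y); rewrite mulNrn e opprK.
pose g i : G := oapp (fun l => (f (x l)).2) 0 (insub i : option 'I_n).
have gx (i : 'I_n) : g i = (f (x i)).2 by rewrite /g valK.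
have hg i : opos (g i).
  rewrite /g; case: insubP => [l _ _|_] /=; [exact: rep_pos|exact: opos0].
have ex := nat_sol_exists HA0 sat0 rr r0.
have [gamma [u [ug up hu]]] :=
  chang_sol_exists ex int (fun i => (f (x i)).1) hg Gdiv.
have /choice[z hz] (j : 'I_m.+1) : exists a, f a = (gamma j, u (n + j)%N).
  by apply: (rep_onto rf); exact: up.
exists z; move: hu; rewrite /chang_sol; congr (efd_sol _ _ _ _); apply/funext => i /=.
  by rewrite /efd_x ug // gx -surjective_pairing.
by rewrite hz.
Qed.

(** * Separating models and classification *)

Definition bool_alg : mvstr := @MVStr bool orb negb false.

Lemma fst_hom (G : zmodType) (P : pred G) :
  @is_hom (chang P) bool_alg (fun x => x.1).
Proof. by split=> [[[] x] [[] y]|[[] x]|]. Qed.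

Definition bool_in (A : mvstr) (b : bool_alg) : A := if b then mvone else mvzero.

Lemma bool_in_hom (A : mvstr) : is_MV A -> is_hom (bool_in A).
Proof.
move=> MV; split=> [[] []|[]|] //=; rewrite /bool_in ?(mvaddm1 MV) ?(mvadd1m MV) ?(mvadd0 MV) //.
by rewrite mvneg1.
Qed.

Lemma bool_satisfies (A : mvstr) phi : is_MVP A -> (exists x y : A, x <> y) ->
  is_efd phi -> satisfies A phi -> satisfies bool_alg phi.
Proof.
case: phi => // n m k s t HA [x0 [y0 xy0]] _ sat x.
have MV := MVP_MV HA; have hi := bool_in_hom MV.
have [a a0] : exists a : A, a <> mvzero.
  have [x0z|] := pselect (x0 = mvzero); last by exists x0.
  by exists y0 => y0z; apply: xy0; rewrite x0z y0z.
have [G [f [rf _]]] := rep_nonzero HA a0; have hf := rep_hom rf.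
pose q := (fun x : chang (@opos G) => x.1 : bool_alg) \o f.
have hq : is_hom q by apply: comp_hom hf _; exact: fst_hom.
have qK (b : bool_alg) : q (bool_in A b) = b.
  by case: b; rewrite /bool_in ?(hom1 hq) ?(hom0 hq).
have [z [hz uz]] := sat (bool_in A \o x).
exists (q \o z); split.
  have := efd_sol_hom hq hz; congr (efd_sol _ _ _ _); apply/funext => i /=.
  exact: qK.
move=> z' hz'; have e := uz _ (efd_sol_hom hi hz').
by apply/funext => j; rewrite /comp e /= qK.
Qed.

Lemma boolean_satisfies (A : mvstr) phi : is_MVP A -> (forall x : A, mvadd x x = x) ->
  is_efd phi -> satisfies bool_alg phi -> satisfies A phi.
Proof.
case: phi => // n m k s t HA idem _ sat.
have snd0 (G : osp) (f : A -> chang (@opos G)) : is_rep f -> forall a, (f a).2 = 0.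
  move=> rf a; have [b fb] := rep_onto rf (y := (false, (f a).2)) (rep_pos rf a).
  have := congr1 f (idem b); rewrite (homD (rep_hom rf)) fb => /(congr1 snd) /=.
  by move/eqP; rewrite -subr_eq0 addrK => /eqP.
have in_hom (G : osp) : @is_hom bool_alg (chang (@opos G)) (fun b => (b, 0)).
  have p0 : opos (0 : G) by exact: opos0.
  split=> [[] []|[]|] //=; rewrite /chang_add /= ?subr0 ?addr0 ?p0 //.
apply: efd_local_global => // G f rf x; have hf := rep_hom rf; last first.
  move=> z z' h h' j.
  have hq := comp_hom hf (fst_hom (@opos G)).
  have [z0 [_ uz]] := sat (fun i => (f (x i)).1).
  have e := etrans (esym (uz _ (efd_sol_hom (fst_hom (@opos G)) h)))
    (uz _ (efd_sol_hom (fst_hom (@opos G)) h')).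
  have ej := congr1 (fun g => g j) e; rewrite /= in ej.
  by rewrite [f (z j)]surjective_pairing [f (z' j)]surjective_pairing !snd0 // ej.
have [z [hz _]] := sat (fun i => (f (x i)).1).
have /choice[w hw] (j : 'I_m.+1) : exists a, f a = (z j, 0).
  by apply: (rep_onto rf); exact: opos0.
exists w; have := efd_sol_hom (in_hom G) hz; congr (efd_sol _ _ _ _); apply/funext => i /=.
  by rewrite [RHS]surjective_pairing snd0.
by rewrite hw.
Qed.

Section ChangMV.
Variable G : osp.
Implicit Types (u v w : G) (x y z : chang (@opos G)).
Let pp u : G := if opos u then u else 0.

Lemma ppos_id u : opos u -> pp u = u.
Proof. by rewrite /pp => ->. Qed.
Lemma ppos_neg u : opos u -> pp (- u) = 0.
Proof. by rewrite /pp => h; case: ifP => // k; rewrite (opos_anti h k) oppr0. Qed.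
Lemma ppos_ppos u v : opos v -> pp (pp u - v) = pp (u - v).
Proof.
move=> hv; rewrite {2}/pp; case: ifP => // hu; rewrite sub0r ppos_neg //.
have hu' : opos (v - u) by apply: oposD => //; apply: oposN; rewrite hu.
by rewrite -opprB ppos_neg.
Qed.

Lemma chang_addA x y z : opos x.2 -> opos y.2 -> opos z.2 ->
  mvadd x (mvadd y z) = mvadd (mvadd x y) z.
Proof.
case: x y z => [b u] [c v] [d w]; rewrite /mvadd /= /chang_add -!/(pp _).
case: b c d => [] [] [] /= hu hv hw; rewrite -?/(pp _) ?ppos_ppos ?sub0r ?ppos_neg //.
- by rewrite opprD addrA.
- by rewrite addrAC.
- by rewrite opprD addrA addrAC.
- by rewrite addrA.
Qed.
Lemma chang_addC x y : mvadd x y = mvadd y x.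
Proof. by case: x y => [[] u] [[] v]; rewrite /mvadd /= /chang_add //= addrC. Qed.
Lemma chang_add0 x : opos x.2 -> mvadd x mvzero = x.
Proof.
by case: x => [[] u]; rewrite /mvadd /= /chang_add /= => hu; rewrite ?subr0 ?addr0 ?hu.
Qed.
Lemma chang_negK x : mvneg (mvneg x) = x.
Proof. by case: x => [[] u]. Qed.
Lemma chang_add1 x : opos x.2 -> mvadd x (mvneg mvzero) = mvneg mvzero.
Proof.
case: x => [[] u] //; rewrite /mvadd /= /chang_add /= => hu.
by rewrite -/(pp _) sub0r ppos_neg.
Qed.
Lemma chang_joinC x y : opos x.2 -> opos y.2 ->
  mvadd (mvneg (mvadd (mvneg x) y)) y = mvadd (mvneg (mvadd (mvneg y) x)) x.
Proof.
case: x y => [b u] [c v]; rewrite /mvadd /mvneg /= /chang_add => hu hv.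
have pn p q : opos (p - q) -> pp (q - p) = 0 by move=> h; rewrite -opprB ppos_neg.
have := opos_total (u - v); rewrite opprB.
case: b c => [] [] /= /orP[h|h]; rewrite -!/(pp _) ?(pn _ _ h) ?(ppos_id h) ?addrK ?subr0 //;
  by rewrite ?subKr ?subrK ?add0r.
Qed.
End ChangMV.

Section LocalizedModel.
Variable S : set nat.

Definition local_int (q : rat) : Prop := forall p, prime p -> ~ S p -> p_int p q.

Lemma local_int_nat (a : nat) : local_int a%:R.
Proof.
move=> p pp _; exists 1%N, (a : int); rewrite mul1r -pmulrn; split=> //.
by rewrite dvdn1; apply/eqP => p1; rewrite p1 in pp.
Qed.
Lemma local_intB x y : local_int x -> local_int y -> local_int (x - y).
Proof. by move=> hx hy p pp nS; apply: p_intB => //; [exact: hx|exact: hy]. Qed.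
Lemma local_intD x y : local_int x -> local_int y -> local_int (x + y).
Proof.
move=> hx hy; rewrite -[y]opprK; apply: local_intB => //.
by rewrite -sub0r; apply: local_intB => //; exact: (local_int_nat 0).
Qed.

Let chQ := chang (@opos rat_osp).
Definition loc_carrier : Type := {x : chQ | 0 <= x.2 :> rat /\ local_int x.2}.

Lemma loc_add_subproof (x y : loc_carrier) :
  0 <= (mvadd (sval x) (sval y)).2 :> rat /\ local_int (mvadd (sval x) (sval y)).2.
Proof.
case: x y => [[b x] [/= px ix]] [[c y] [/= py iy]]; rewrite /= /chang_add /opos /=.
have i0 := local_int_nat 0.
case: b c => [] [] /=; split=> //; do ?case: ifP => // _; do ?exact: local_intB.
  exact: addr_ge0.
exact: local_intD.
Qed.
Lemma loc_neg_subproof (x : loc_carrier) :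
  0 <= (mvneg (sval x)).2 :> rat /\ local_int (mvneg (sval x)).2.
Proof. by case: x => [[b x] [/= px ix]]. Qed.
Lemma loc_zero_subproof : 0 <= (mvzero : chQ).2 :> rat /\ local_int (mvzero : chQ).2.
Proof. by split=> //; exact: (local_int_nat 0). Qed.

(* The perfect chain of the group of rationals whose denominators are products
   of primes in [S]. *)
Definition loc : mvstr := @MVStr loc_carrier
  (fun x y => exist _ _ (loc_add_subproof x y))
  (fun x => exist _ _ (loc_neg_subproof x)) (exist _ _ loc_zero_subproof).

Lemma loc_hom : @is_hom loc chQ (fun x => sval x).
Proof. by []. Qed.

Lemma loc_MV : is_MV loc.
Proof.
split.
- move=> [x [px ix]] [y [py iy]] [z [pz iz]]; apply: sval_inj; exact: chang_addA.
- move=> [x [px ix]] [y [py iy]]; apply: sval_inj; exact: chang_addC.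
- move=> [x [px ix]]; apply: sval_inj; exact: chang_add0.
- move=> [x [px ix]]; apply: sval_inj; exact: chang_negK.
- move=> [x [px ix]]; apply: sval_inj; exact: chang_add1.
- move=> [x [px ix]] [y [py iy]]; apply: sval_inj; exact: chang_joinC.
Qed.
End LocalizedModel.

Section LocProperties.
Variable S : set nat.
Notation D := (loc S).

Definition loc_side (x : D) : bool_alg := (sval x).1.

Lemma loc_side_hom : is_hom loc_side.
Proof. exact: comp_hom (@loc_hom S) (fst_hom _). Qed.

Lemma loc_side_surj (b : bool_alg) : exists x : D, loc_side x = b.
Proof. by case: b; [exists (mvneg mvzero)|exists mvzero]. Qed.

Lemma loc_perfect : perfect D.
Proof.
have MV := loc_MV S; have hs := loc_side_hom.
split; first exact: MV.
  by exists mvzero, (mvneg mvzero) => /(congr1 loc_side).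
pose M : set D := [set x | loc_side x = false].
have idM : is_ideal M.
  split; first by exists mvzero.
    move=> x y; rewrite /mvle => xy; rewrite /M /= => y0.
    move: (congr1 loc_side xy); rewrite (hom_join hs) y0 /mvjoin /=.
    by case: (loc_side x).
  by move=> x y; rewrite /M /= (homD hs) => -> ->.
have MT : M <> setT.
  move=> e; have : M (mvneg mvzero) by rewrite e.
  by [].
have sub (I : set D) : is_ideal I -> I <> setT -> I `<=` M.
  move=> hI nT x Ix; rewrite /M /=; case e : (loc_side x) => //; exfalso; apply: nT.
  rewrite predeqE => y; split=> // _; apply: (ideal_down hI _ (ideal_add hI Ix Ix)).
  have -> : mvadd x x = mvone.
    apply: sval_inj; move: e; rewrite /loc_side /=.
    by case: (sval x) => [[] v].
  by apply/mvleE => //; exact: mvlem1.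
have rM x : M x -> mvrad D x.
  move=> Mx I [hI nT mI]; rewrite -(mI M) //; exact: sub.
rewrite predeqE => x; split=> // _; case e : (loc_side x); last by left; exact: rM.
right; exists (mvneg x); last exact: mvnegK.
by apply: rM; rewrite /M /= (homN hs) e.
Qed.

Lemma loc_VP : VP D.
Proof. by move=> K _ h; apply: h; exact: loc_perfect. Qed.
Lemma loc_MVP : is_MVP D. Proof. exact: VP_MVP loc_VP. Qed.

Lemma loc_one_subproof (b : bool) :
  0 <= ((b, 1) : chang (@opos rat_osp)).2 :> rat /\
  local_int S ((b, 1) : chang (@opos rat_osp)).2.
Proof. by split=> //; exact: (local_int_nat 1). Qed.
Definition loc_one : D := exist _ _ (loc_one_subproof false).

Lemma loc_epsilon p : prime p -> satisfies D (epsilon p) <-> S p.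
Proof.
move=> pp; have p0 := prime_gt0 pp.
rewrite (epsilon_exP loc_MVP p0).
have tE (z : D) : sval (t_ p z) = chang_scale p (sval z).
  by rewrite (hom_t (@loc_hom S)) chang_tE //; case: (svalP z).
split=> [h|Sp [[b q] [q0 qi]]].
  apply: contrapT => nS; have [z hz] := h loc_one.
  have := congr1 (fun x : D => (sval x).2) hz; rewrite tE /=.
  have [_ zi] := svalP z; have {}zi := zi p pp nS.
  set q : rat := (sval z).2 in zi *.
  move=> e; have {}e : q * p%:R = 1 by rewrite mulr_natr; exact: e.
  have [N [c [pN Nc]]] := zi.
  have : N%:R = c%:~R * p%:R :> rat by rewrite -Nc -mulrA e mulr1.
  rewrite !pmulrn -rmorphM => /eqP; rewrite eqr_int => /eqP NE.
  by move: pN; rewrite -(absz_nat N) NE abszM absz_nat dvdn_mull.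
have ok : 0 <= ((b, q / p%:R) : chang (@opos rat_osp)).2 :> rat /\
    local_int S ((b, q / p%:R) : chang (@opos rat_osp)).2.
  split; first by rewrite /= divr_ge0 // ler0n.
  move=> p' pp' nS; have [N [c [pN Nc]]] := qi p' pp' nS; exists (N * p)%N, c; split.
    rewrite Euclid_dvdM // negb_or pN dvdn_prime2 //; apply/eqP => e.
    by apply: nS; rewrite e.
  by rewrite -Nc natrM /= -mulrA [p%:R * _]mulrC divfK // pnatr_eq0 -lt0n.
exists (exist _ (b, q / p%:R) ok : D); apply: sval_inj; rewrite tE /chang_scale; congr (_, _).
transitivity ((q / p%:R) * p%:R); first exact: esym (mulr_natr _ _).
by rewrite divfK // pnatr_eq0 -lt0n.
Qed.

Lemma loc_not_boolean : mvadd loc_one loc_one <> loc_one.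
Proof. by move=> /(congr1 (fun x : D => (sval x).2)). Qed.
End LocProperties.

Lemma VP_surj (A B : mvstr) (f : A -> B) : is_hom f ->
  (forall b, exists a, f a = b) -> VP A -> VP B.
Proof. by move=> hf sf hA K vK hK; apply: (variety_hom vK hf sf); exact: hA. Qed.

Lemma bool_VP : VP bool_alg.
Proof. exact: VP_surj (loc_side_hom set0) (@loc_side_surj _) (loc_VP _). Qed.

Lemma models_triv (A : mvstr) : models A Sigma_triv <-> forall x y : A, x = y.
Proof.
split=> [h x y|h phi ->]; last by move=> x; exact: h.
by have := h _ erefl (fun i => if i == ord0 then x else y).
Qed.
Lemma models_bool (A : mvstr) : models A Sigma_bool <-> forall x : A, mvadd x x = x.
Proof.
by split=> [h x|h phi ->]; [have := h _ erefl (fun=> x)|move=> x; exact: h].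
Qed.
Lemma models_Sigma A S : models A (Sigma_ S) <-> forall p, S p -> satisfies A (epsilon p).
Proof.
split=> [h p Sp|h phi [p Sp <-]]; last exact: h.
by apply: h; exists p.
Qed.

Lemma trivial_satisfies (A : mvstr) phi : (forall x y : A, x = y) -> is_efd phi -> satisfies A phi.
Proof.
case: phi => // n m k s t h _ x; exists (fun=> mvzero); split=> [i|z _]; first exact: h.
by apply/funext => j; exact: h.
Qed.

Lemma bool_epsilon p : prime p -> satisfies bool_alg (epsilon p).
Proof.
move=> pp; apply: (@bool_satisfies (loc setT)) => //; first exact: loc_MVP.
  by exists mvzero, (mvneg mvzero) => /(congr1 (@loc_side _)).
by apply/loc_epsilon.
Qed.

Lemma bool_idem (x : bool_alg) : mvadd x x = x. Proof. by case: x. Qed.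

Lemma boolean_epsilon (A : mvstr) p : is_MVP A -> (forall x : A, mvadd x x = x) -> prime p ->
  satisfies A (epsilon p).
Proof. by move=> HA idem pp; apply: boolean_satisfies => //; exact: bool_epsilon. Qed.

Lemma equiv_overC K Sigma Sigma' : equiv_over K Sigma Sigma' -> equiv_over K Sigma' Sigma.
Proof. by move=> h A KA; rewrite h. Qed.

Lemma classification (Sigma : set sentence) : Sigma `<=` is_efd ->
  exists T, canonical_axioms T /\ equiv_over VP Sigma T.
Proof.
move=> efd.
have triv_mod (A : mvstr) : (forall x y : A, x = y) -> models A Sigma.
  by move=> h phi /efd; exact: trivial_satisfies.
have nontriv (A : mvstr) : ~ (forall x y : A, x = y) -> exists x y : A, x <> y.
  move=> h; apply: contrapT => no; apply: h => x y; apply: contrapT => xy.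
  by apply: no; exists x, y.
have [hb|nb] := pselect (models bool_alg Sigma); last first.
  exists Sigma_triv; split; first by constructor 1.
  move=> A VA; rewrite models_triv; split; last exact: triv_mod.
  move=> hA; apply: contrapT => /nontriv ne; apply: nb => phi Sphi.
  by apply: (bool_satisfies (VP_MVP VA)); [|exact: efd|exact: hA].
have bool_mod A : VP A -> (forall x : A, mvadd x x = x) -> models A Sigma.
  move=> VA idem phi Sphi; apply: boolean_satisfies (VP_MVP VA) idem (efd _ Sphi) (hb _ Sphi).
have [[A0 [VA0 hA0 [a na]]]|no] := pselect (exists A0, [/\ VP A0, models A0 Sigma &
    exists a : A0, mvadd a a <> a]); last first.
  exists Sigma_bool; split; first by constructor 2.
  move=> A VA; rewrite models_bool; split; last exact: bool_mod.
  by move=> hA x; apply: contrapT => nx; apply: no; exists A; split=> //; exists x.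
pose S : set nat := [set p | prime p /\
  forall A, VP A -> models A Sigma -> satisfies A (epsilon p)].
exists (Sigma_ S); split; first by constructor 3; exists S => // p [].
move=> A VA; rewrite models_Sigma; split=> [hA p [_ hp]|hA phi Sphi]; first exact: hp.
have HA0 := VP_MVP VA0; have := efd _ Sphi; have := hA0 _ Sphi.
have other p : prime p -> ~ S p -> exists B : mvstr,
    [/\ is_MVP B, satisfies B phi & ~ satisfies B (epsilon p)].
  move=> pp nS; apply: contrapT => no; apply: nS; split=> // B VB hB.
  by apply: contrapT => nB; apply: no; exists B; split=> //; [exact: VP_MVP|exact: hB].
case: phi Sphi other => // n m k s t _ other sat0 _.
apply: (efd_satisfied HA0 sat0 (radpart_rad a) (radpart_neq0 HA0 na) other (VP_MVP VA)).
by move=> p _; exact: hA.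
Qed.

Lemma Sigma_le S S' : prime_set S -> prime_set S' ->
  (forall A, VP A -> models A (Sigma_ S) -> models A (Sigma_ S')) <-> S' `<=` S.
Proof.
move=> hS hS'; split=> [h p S'p|sub A _ /models_Sigma h]; last first.
  by apply/models_Sigma => p /sub; exact: h.
have : models (loc S) (Sigma_ S').
  apply: h; first exact: loc_VP.
  by apply/models_Sigma => q Sq; apply/loc_epsilon => //; exact: hS.
by move=> /models_Sigma/(_ _ S'p)/loc_epsilon; apply; exact: hS'.
Qed.

Lemma Sigma_inj S S' : prime_set S -> prime_set S' ->
  equiv_over VP (Sigma_ S) (Sigma_ S') -> S = S'.
Proof.
move=> hS hS' h; apply/seteqP; split.
  by apply/(Sigma_le hS' hS) => A VA; rewrite h.
by apply/(Sigma_le hS hS') => A VA; rewrite h.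
Qed.

Lemma loc_not_bool S : ~ models (loc S) Sigma_bool.
Proof. by move=> /models_bool/(_ (loc_one S)); exact: loc_not_boolean. Qed.
Lemma bool_not_triv : ~ models bool_alg Sigma_triv.
Proof. by move=> /models_triv/(_ true false). Qed.
Lemma bool_models_bool : models bool_alg Sigma_bool.
Proof. by apply/models_bool; exact: bool_idem. Qed.
Lemma bool_models_Sigma S : prime_set S -> models bool_alg (Sigma_ S).
Proof. by move=> hS; apply/models_Sigma => p /hS; exact: bool_epsilon. Qed.
Lemma loc_models S : prime_set S -> models (loc S) (Sigma_ S).
Proof. by move=> hS; apply/models_Sigma => p Sp; apply/loc_epsilon => //; exact: hS. Qed.

Lemma canonical_inj T T' : canonical_axioms T -> canonical_axioms T' ->
  equiv_over VP T T' -> T = T'.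
Proof.
have tb : ~ equiv_over VP Sigma_triv Sigma_bool.
  move=> h; apply: bool_not_triv; apply/(h _ bool_VP); exact: bool_models_bool.
have tS S : prime_set S -> ~ equiv_over VP Sigma_triv (Sigma_ S).
  move=> hS h; apply: bool_not_triv; apply/(h _ bool_VP); exact: bool_models_Sigma.
have bS S : prime_set S -> ~ equiv_over VP Sigma_bool (Sigma_ S).
  move=> hS h; apply: (@loc_not_bool S); apply/(h _ (loc_VP S)); exact: loc_models.
move=> [->|->|[S hS ->]] [->|->|[S' hS' ->]] h.
- by [].
- by case: tb.
- by case: (tS S').
- by case: tb; exact: equiv_overC.
- by [].
- by case: (bS S').
- by case: (tS S) => //; exact: equiv_overC.
- by case: (bS S) => //; exact: equiv_overC.
- by rewrite (Sigma_inj hS hS' h).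
Qed.

Lemma prime_enumeration : exists e : nat -> nat,
  [/\ injective e, forall i, prime (e i) & forall p, prime p -> exists i, e i = p].
Proof.
have inf : ~ finite_set [set p | prime p].
  move=> /finite_seqP[r rE].
  have [p pm pp] := prime_above (\max_(x <- r) x).
  have pr : p \in r by have : [set p | prime p] p by []; rewrite rE.
  by have := @leq_bigmax_seq _ r xpredT id p pr isT; rewrite leqNgt pm.
have /card_set_bijP[e [e1 e2 e3]] : ([set: nat] #= [set p | prime p])%card.
  by rewrite card_eq_sym; apply: eq_card_nat inf; exact: countableP.
exists e; split.
- by move=> i j ij; apply: e2; rewrite ?in_setT.
- by move=> i; exact: e1.
- by move=> p /e3[i _ <-]; exists i.
Qed.

Section LatticeIso.
Variable e : nat -> nat.
Hypotheses (e_inj : injective e) (e_prime : forall i, prime (e i))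
  (e_surj : forall p, prime p -> exists i, e i = p).

Definition code_primes (X : set nat) : set nat := [set e i | i in ~` X].

Definition code_axioms (a : bool + set nat) : set sentence :=
  match a with
  | inl false => Sigma_triv
  | inl true => Sigma_bool
  | inr X => Sigma_ (code_primes X)
  end.

Lemma code_primes_prime X : prime_set (code_primes X).
Proof. by move=> p [i _ <-]. Qed.

Lemma code_primes_le X Y : code_primes Y `<=` code_primes X <-> X `<=` Y.
Proof.
split=> [h i Xi|h p [i nY <-]]; last by exists i => // /h.
apply: contrapT => nY; have [|j nX /e_inj ji] := h (e i); first by exists i.
by apply: nX; rewrite ji.
Qed.

Lemma code_axioms_canonical T : canonical_axioms T <-> exists a, code_axioms a = T.
Proof.
split=> [[->|->|[S hS ->]]|[[[]|X] <-]].
- by exists (inl false).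
- by exists (inl true).
- exists (inr [set i | ~ S (e i)]); rewrite /=; congr Sigma_.
  apply/seteqP; split=> [p [i /contrapT Si <-] //|p Sp].
  have [i ei] := e_surj (hS _ Sp); exists i => //; apply; by rewrite ei.
- by constructor 2.
- by constructor 1.
- by constructor 3; exists (code_primes X) => //; exact: code_primes_prime.
Qed.

Definition code_class (a : bool + set nat) (A : mvstr) : Prop :=
  VP A /\ models A (code_axioms a).

(* The trivial and the Boolean algebras are cut out by the EFD-sentences
   [exists! z, z = z] and [forall x, exists! z, 2x = x /\ z = x]. *)
Lemma code_class_AE a : is_AE_subclass (code_class a).
Proof.
case: a => [[]|X].
- pose s (i : 'I_2) : term ('I_1 + 'I_1) :=
    if i == ord0 then TAdd (TVar (inl ord0)) (TVar (inl ord0)) else TVar (inr ord0).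
  pose t (i : 'I_2) : term ('I_1 + 'I_1) := TVar (inl ord0).
  exists [set @Efd 1 0 1 s t]; first by move=> phi ->.
  move=> A; rewrite /code_class /= models_bool; split=> -[VA h]; split=> //.
    move=> phi -> x; exists x; split=> [i|z hz].
      by rewrite /s; case: eqP => _ /=.
    by apply/funext => j; rewrite (ord1 j); have := hz ord_max.
  move=> x; have [z [hz _]] := h _ erefl (fun=> x).
  by have := hz ord0.
- pose s (i : 'I_1) : term ('I_0 + 'I_1) := TVar (inr ord0).
  exists [set @Efd 0 0 0 s s]; first by move=> phi ->.
  move=> A; rewrite /code_class /= models_triv; split=> -[VA h]; split=> //.
    by move=> phi ->; exact: trivial_satisfies.
  move=> x y; have [z [_ uz]] := h _ erefl (fun=> x).
  have ex := uz (fun=> x) (fun=> erefl); have ey := uz (fun=> y) (fun=> erefl).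
  by have := congr1 (fun g => g ord0) (etrans (esym ex) ey).
- exists (code_axioms (inr X)); first by move=> phi [p _ <-].
  by move=> A.
Qed.

Definition code_AE (a : bool + set nat) : AE_subclass := exist _ _ (code_class_AE a).

Lemma code_AE_le a b : AE_le (code_AE a) (code_AE b) <->
  @ordinal_sum_le _ _ (bool : latticeType _) (set nat : latticeType _) a b.
Proof.
rewrite /AE_le /= /code_class.
have triv_all T : canonical_axioms T -> forall A : mvstr, (forall x y : A, x = y) -> models A T.
  move=> [->|->|[S hS ->]] A h.
  - exact/models_triv.
  - exact/models_bool.
  - by apply/models_Sigma => p _; exact: trivial_satisfies.
case: a b => [[]|X] [[]|Y] /=.
- by split.
- split=> // h; have [|_ hb] := h bool_alg; last by case: bool_not_triv.
  by split; [exact: bool_VP|exact: bool_models_bool].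
- split=> // _ A [VA /models_bool idem]; split=> //; apply/models_Sigma => p [i _ <-].
  by apply: boolean_epsilon => //; exact: VP_MVP.
- split=> // _ A [VA /models_triv h]; split=> //; apply/models_bool => x; exact: h.
- by split.
- split=> // _ A [VA /models_triv h]; split=> //; apply: triv_all => //.
  by constructor 3; exists (code_primes Y) => //; exact: code_primes_prime.
- split=> // h; have [|_ hb] := h (loc (code_primes X)).
    by split; [exact: loc_VP|apply: loc_models; exact: code_primes_prime].
  by case: (@loc_not_bool (code_primes X)).
- split=> // h; have [|_ hb] := h bool_alg; last by case: bool_not_triv.
  by split; [exact: bool_VP|apply: bool_models_Sigma; exact: code_primes_prime].
rewrite subsetEset -code_primes_le -Sigma_le; try exact: code_primes_prime.
by split=> [h A VA hA|h A [VA hA]]; [have [] := h A|split=> //; exact: h].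
Qed.

Lemma ordinal_sum_anti a b :
  @ordinal_sum_le _ _ (bool : latticeType _) (set nat : latticeType _) a b ->
  @ordinal_sum_le _ _ (bool : latticeType _) (set nat : latticeType _) b a -> a = b.
Proof.
case: a b => [x|X] [y|Y] //= h h'; congr (_ _); apply/eqP; rewrite Order.POrderTheory.eq_le.
  by rewrite h.
by rewrite h h'.
Qed.

Lemma code_AE_inj : injective code_AE.
Proof. by move=> a b ab; apply: ordinal_sum_anti; apply/code_AE_le; rewrite ab. Qed.

Lemma code_AE_surj K : exists a, code_AE a = K.
Proof.
case: K => K [Sigma efd hK].
have [T [/code_axioms_canonical[a <-] hT]] := classification efd.
exists a; apply: eq_exist; apply/funext => A; apply/propext.
by rewrite hK /code_class; split=> -[VA h]; split=> //; apply/hT.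
Qed.

Lemma AE_lattice_iso : order_isomorphic AE_le
  (@ordinal_sum_le _ _ (bool : latticeType _) (set nat : latticeType _)).
Proof.
have /choice[f fK] := code_AE_surj.
have Kf a : f (code_AE a) = a by apply: code_AE_inj; exact: fK.
exists f; first by exists code_AE.
by move=> x y; rewrite -{1}(fK x) -{1}(fK y); exact: code_AE_le.
Qed.
End LatticeIso.

Theorem theorem5p15 :
  [/\ forall Sigma : set sentence, Sigma `<=` is_efd ->
        exists! T : set sentence, canonical_axioms T /\ equiv_over VP Sigma T,
      forall S S' : set nat, prime_set S -> prime_set S' ->
        equiv_over VP (Sigma_ S) (Sigma_ S') -> S = S' &
      order_isomorphic AE_le
        (@ordinal_sum_le _ _ (bool : latticeType _) (set nat : latticeType _))].
Proof.
split.
- move=> Sigma efd; have [T [cT hT]] := classification efd.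
  exists T; split=> // T' [cT' hT']; apply: canonical_inj => // A VA.
  by rewrite -hT // -hT'.
- exact: Sigma_inj.
- have [e [e_inj e_prime e_surj]] := prime_enumeration.
  exact: (AE_lattice_iso e_inj e_prime e_surj).
Qed.
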